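(* Let $\gamma,\kappa,\zeta>0$, and let $G_\zeta(\phi)=\exp(-\phi^2/(2\zeta^2))$. Consider one of two cases: the symmetric case, in which $\kappa<\zeta^2$ and $\sigma=\sigma_s$; or the non-symmetric case, in which $\kappa<2\zeta^2$ and $\sigma=\sigma_a$, where $$\sigma_s^2=\frac{\zeta^2}{2\left(\frac{\zeta^2}{\kappa}-1\right)},\qquad \sigma_a^2=\frac{\zeta^2}{\frac{2\zeta^2}{\kappa}-1}.$$ Assume that, in the case considered, the Gaussian probability densities $F_{\sigma,\varphi}$, $\varphi\in\mathbb{R}$, are the only equilibria of $Q$ (i.e. the only probability densities on $\mathbb{R}$ with $Q(F_{\sigma,\varphi})=0$). Let $f^\varepsilon=f^\varepsilon(\alpha,\phi,t)$ be a solution of $$\frac{\partial f^\varepsilon}{\partial t}+R^\varepsilon=\frac{1}{\varepsilon^2}Q(f^\varepsilon),$$ and suppose that $f^\varepsilon\to f$ as $\varepsilon\to0$ as nicely as needed. Then, as $\varepsilon\to 0$, $f^\varepsilon$ formally converges to a local thermodynamical equilibrium $f(\alpha,\phi,t)=\rho(\alpha,t)F_{\sigma,\varphi(\alpha,t)}(\phi)$, i.e. $f^\varepsilon(\alpha,\phi,t)=\rho(\alpha,t)F_{\sigma,\varphi(\alpha,t)}(\phi)+\mathcal{O}(\varepsilon^2)$ in a suitable topology, where $\rho$ is constant in time ($\partial_t\rho=0$) and the density of opinion $\rho\varphi$ evolves according to the following diffusion equation in regions where $\rho>0$: (i) in the symmetric case, $$\frac{\partial}{\partial t}(\rho\varphi)=C_s\,\nabla_\alpha\cdot\left(\rho^2\nabla_\alpha\varphi\right),\qquad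 C_s:=\gamma D\,\frac{\zeta^3}{(2\sigma_s^2+\zeta^2)^{3/2}};$$ (ii) in the non-symmetric case, $$\frac{\partial}{\partial t}(\rho\varphi)=\frac{C_a}{\rho}\,\nabla_\alpha\cdot\left(\rho^2\nabla_\alpha\varphi\right),\qquad C_a:=\gamma D\,\frac{\zeta^2}{\sigma_a^2+\zeta^2}.$$
   Context: Variables: position $\alpha\in\mathbb{R}^n$, $n\in\{1,2,3\}$; opinion $\phi\in\mathbb{R}$; time $t\ge 0$. The unknown $f^\varepsilon(\alpha,\phi,t)\ge0$ is a density of agents in $(\alpha,\phi)$-space. The symbol $*$ denotes convolution in the opinion variable $\phi$ only, $\phi G_\zeta$ denotes the function $\phi\mapsto\phi\,G_\zeta(\phi)$, and $(\phi G_\zeta)*f(\phi)=\int_{\mathbb{R}}(\phi-\psi)G_\zeta(\phi-\psi)f(\psi)\,d\psi$. $\Delta_\alpha,\nabla_\alpha$ act on $\alpha$. Gaussian: $F_{\sigma,\varphi}(\phi)=\frac{1}{\sqrt{2\pi}\,\sigma}\exp\left(-\frac{|\phi-\varphi|^2}{2\sigma^2}\right)$. Diffusion constant: $D=\frac{1}{2n}\int_{\mathbb{R}^n}F(|\alpha|)|\alpha|^2\,d\alpha$, where $F\ge0$ is a given spatial interaction kernel with $\int_{\mathbb{R}^n}F(|\alpha|)\,d\alpha=1$. Collision operator (acting on the $\phi$ variable only): $$Q(f)=\gamma\,\partial_\phi\left\{\frac{(\phi G_\zeta)*f}{H(G_\zeta*f)}\,f+\frac{\kappa}{2}\,\partial_\phi\left(\frac{G_\zeta*f}{H(G_\zeta*f)}\,f\right)\right\},$$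 where $H(g)=1$ for all $g\ge0$ in the symmetric case and $H(g)=g$ for all $g\ge 0$ in the non-symmetric case. The term $R^\varepsilon$: in the symmetric case $$R^\varepsilon=-\gamma D\,\partial_\phi\left\{\big((\phi G_\zeta)*\Delta_\alpha f^\varepsilon\big)f^\varepsilon+\frac{\kappa}{2}\,\partial_\phi\Big((G_\zeta*\Delta_\alpha f^\varepsilon)f^\varepsilon\Big)\right\};$$ in the non-symmetric case $$R^\varepsilon=-\gamma D\,\partial_\phi\left\{\frac{(\phi G_\zeta)*\Delta_\alpha f^\varepsilon}{G_\zeta*f^\varepsilon}\,f^\varepsilon-\frac{(\phi G_\zeta)*f^\varepsilon}{(G_\zeta*f^\varepsilon)^2}\,f^\varepsilon\,(G_\zeta*\Delta_\alpha f^\varepsilon)\right\}.$$ The limit is a formal one: ''formally'', ''as nicely as needed'' and ''in a suitable topology'' mean that solutions are taken to be smooth and to decay fast enough as $|\phi|\to\infty$, that one may pass to the limit in all terms of the equation and in its integrals against functions of $\phi$, and that $f^\varepsilon$ has an expansion $f^\varepsilon=f+\varepsilon^2f_1+o(\varepsilon^2)$. The functions $\rho$ and $\varphi$ are given by $\int_{\mathbb{R}}f\,d\phi=\rho$ and $\int_{\mathbb{R}}f\,\phi\,d\phi=\rho\varphi$. *)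

(* Defs.v *)
From HB Require Import structures.
From mathcomp Require Import all_boot all_order all_algebra.
From mathcomp Require Import all_classical all_reals all_analysis.

Set Implicit Arguments.
Unset Strict Implicit.
Unset Printing Implicit Defensive.

Import Order.TTheory GRing.Theory Num.Theory.
Import numFieldNormedType.Exports.
Local Open Scope classical_set_scope.
Local Open Scope ring_scope.

(* Functions of (position, opinion, time); only their values at times t >= 0
   are ever used. *)
Notation phase_fun R n := ('rV[R]_n -> R -> R -> R).

(** * Calculus *)

(* The norm `|_| of the library on 'rV_n is the sup norm. *)
Definition euclidean_norm (R : realType) (n : nat) (a : 'rV[R]_n) : R :=
  Num.sqrt (\sum_i a 0 i ^+ 2).

(* Iterated integral; for nonnegative measurable integrands it is the Lebesgue
   integral over R^n (Tonelli). *)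
Fixpoint integral_Rn (R : realType) (n : nat) : ('rV[R]_n -> \bar R) -> \bar R :=
  match n return ('rV[R]_n -> \bar R) -> \bar R with
  | 0 => fun h => h 0
  | m.+1 => fun h =>
      (\int[lebesgue_measure]_x
         integral_Rn (fun v : 'rV[R]_m => h (row_mx (x%:M : 'rV[R]_1) v)))%E
  end.

Definition partial (R : realType) (n : nat) (i : 'I_n) (h : 'rV[R]_n -> R)
    (a : 'rV[R]_n) : R := 'D_(delta_mx 0 i) h a.

Definition grad (R : realType) (n : nat) (h : 'rV[R]_n -> R) (a : 'rV[R]_n) :
  'rV[R]_n := \row_i partial i h a.

Definition divergence (R : realType) (n : nat) (V : 'rV[R]_n -> 'rV[R]_n)
    (a : 'rV[R]_n) : R := \sum_i partial i (fun b => V b 0 i) a.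

Definition laplacian (R : realType) (n : nat) (h : 'rV[R]_n -> R)
    (a : 'rV[R]_n) : R := \sum_i partial i (partial i h) a.

(* Derivative of a function of time, within the time domain [0, +oo[: it is
   the usual derivative for t > 0 and the right derivative for t = 0. *)
Definition time_quotient (R : realType) (g : R -> R) (t s : R) : R :=
  (g s - g t) / (s - t).

Definition is_time_derive (R : realType) (g : R -> R) (t l : R) : Prop :=
  time_quotient g t @ within [set s | 0 <= s] t^' --> l.

Definition time_derive (R : realType) (g : R -> R) (t : R) : R :=
  lim (time_quotient g t @ within [set s | 0 <= s] t^').

Definition time_derivable (R : realType) (g : R -> R) (t : R) : Prop :=
  cvg (time_quotient g t @ within [set s | 0 <= s] t^').

Variant direction (n : nat) : Type :=
  | Position of 'I_n
  | Opinion
  | Time.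
Arguments Opinion {n}.
Arguments Time {n}.

Definition pderive (R : realType) (n : nat) (d : direction n) (u : phase_fun R n) :
    phase_fun R n :=
  match d with
  | Position i => fun a p t => partial i (fun b => u b p t) a
  | Opinion => fun a p t => derive1 (fun q => u a q t) p
  | Time => fun a p t => time_derive (u a p) t
  end.

Definition pderivable (R : realType) (n : nat) (d : direction n)
    (u : phase_fun R n) (a : 'rV[R]_n) (p t : R) : Prop :=
  match d with
  | Position i => derivable (fun b => u b p t) a (delta_mx 0 i)
  | Opinion => derivable (fun q => u a q t) p 1
  | Time => time_derivable (u a p) t
  end.

Definition pderives (R : realType) (n : nat) (k : seq (direction n))
    (u : phase_fun R n) : phase_fun R n := foldr (@pderive R n) u k.

(** * Smooth, rapidly decaying functions and their topology *)

(* C^oo on R^n x R x [0, +oo[, up to and including t = 0. *)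
Definition smooth (R : realType) (n : nat) (u : phase_fun R n) : Prop :=
  forall k : seq (direction n),
    {within [set z : 'rV[R]_n * R * R | 0 <= z.2],
      continuous (fun z : 'rV[R]_n * R * R =>
                    pderives k u z.1.1 z.1.2 z.2)} /\
    (forall d a p t, 0 <= t -> pderivable d (pderives k u) a p t).

(* The seminorm sup |p|^m |d^k u(a, p, t)| over |a| <= r, 0 <= t <= r and
   p in R is at most c.  These seminorms (all r, k, m) define the topology in
   which all limits of functions of (a, p, t) are taken: convergence of all
   derivatives, against all polynomial weights in p, locally uniformly in
   (a, t). *)
Definition seminorm_le (R : realType) (n : nat) (r : R)
    (k : seq (direction n)) (m : nat) (u : phase_fun R n) (c : R) : Prop :=
  forall a p t, `|a| <= r -> 0 <= t <= r ->
    `|p| ^+ m * `|pderives k u a p t| <= c.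

Definition rapidly_decaying (R : realType) (n : nat) (u : phase_fun R n) : Prop :=
  forall r k m, exists c, seminorm_le r k m u c.

Definition regular (R : realType) (n : nat) (u : phase_fun R n) : Prop :=
  smooth u /\ rapidly_decaying u.

(* u_eps = O(eps^2) and u_eps = o(eps^2) as eps -> 0+. *)
Definition bigO_eps2 (R : realType) (n : nat) (u : R -> phase_fun R n) : Prop :=
  forall r k m, exists C : R,
    \forall e \near 0^'+, seminorm_le r k m (u e) (C * e ^+ 2).

Definition littleo_eps2 (R : realType) (n : nat) (u : R -> phase_fun R n) : Prop :=
  forall r k m (d : R), 0 < d ->
    \forall e \near 0^'+, seminorm_le r k m (u e) (d * e ^+ 2).

(* feps = f + eps^2 f1 + o(eps^2); this entails feps -> f. *)
Definition converges_nicely (R : realType) (n : nat) (feps : R -> phase_fun R n)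
    (f : phase_fun R n) : Prop :=
  regular f /\
  exists2 f1 : phase_fun R n, regular f1 &
    littleo_eps2 (fun e a p t => feps e a p t - f a p t - e ^+ 2 * f1 a p t).

(** * The kinetic model *)

Variant model_case := Symmetric | NonSymmetric.

Definition H (R : realType) (c : model_case) (x : R) : R :=
  match c with Symmetric => 1 | NonSymmetric => x end.

Definition G (R : realType) (zeta x : R) : R :=
  expR (- (x ^+ 2) / (2 * zeta ^+ 2)).

Definition idG (R : realType) (zeta x : R) : R := x * G zeta x.

Definition convolution (R : realType) (K g : R -> R) (x : R) : R :=
  \int[lebesgue_measure]_y (K (x - y) * g y).

Definition Q (R : realType) (c : model_case) (gamma kappa zeta : R) (g : R -> R) :
    R -> R :=
  let Gg := convolution (G zeta) g in
  fun p => gamma *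
    derive1 (fun q =>
      convolution (idG zeta) g q / H c (Gg q) * g q
      + kappa / 2 * derive1 (fun s => Gg s / H c (Gg s) * g s) q) p.

Definition Rterm (R : realType) (n : nat) (c : model_case) (gamma kappa zeta D : R)
    (u : phase_fun R n) : phase_fun R n :=
  fun a p t =>
    let g := fun q => u a q t in
    let lap_g := fun q => laplacian (fun b => u b q t) a in
    let Gg := convolution (G zeta) g in
    match c with
    | Symmetric => - gamma * D *
        derive1 (fun q =>
          convolution (idG zeta) lap_g q * g q
          + kappa / 2 * derive1 (fun s => convolution (G zeta) lap_g s * g s) q) p
    | NonSymmetric => - gamma * D *
        derive1 (fun q =>
          convolution (idG zeta) lap_g q / Gg q * g q
          - convolution (idG zeta) g q / Gg q ^+ 2 * g q
            * convolution (G zeta) lap_g q) p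
    end.

Definition interaction_kernel (R : realType) (n : nat) (F : R -> R) : Prop :=
  [/\ forall x, 0 <= x -> 0 <= F x,
      measurable_fun (`[0, +oo[ : set R) F,
      integral_Rn (fun a : 'rV[R]_n => (F (euclidean_norm a))%:E) = 1%E &
      (integral_Rn (fun a : 'rV[R]_n =>
         (F (euclidean_norm a) * euclidean_norm a ^+ 2)%:E) < +oo)%E].

Definition diffusion_constant (R : realType) (n : nat) (F : R -> R) : R :=
  fine (integral_Rn (fun a : 'rV[R]_n =>
    (F (euclidean_norm a) * euclidean_norm a ^+ 2)%:E)) / (2 * n%:R).

Definition kappa_condition (R : realType) (c : model_case) (kappa zeta : R) : Prop :=
  match c with
  | Symmetric => kappa < zeta ^+ 2
  | NonSymmetric => kappa < 2 * zeta ^+ 2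
  end.

Definition sigma (R : realType) (c : model_case) (kappa zeta : R) : R :=
  Num.sqrt match c with
  | Symmetric => zeta ^+ 2 / (2 * (zeta ^+ 2 / kappa - 1))
  | NonSymmetric => zeta ^+ 2 / (2 * zeta ^+ 2 / kappa - 1)
  end.

Definition probability_density (R : realType) (g : R -> R) : Prop :=
  [/\ forall x, 0 <= g x, measurable_fun setT g &
      (\int[lebesgue_measure]_x (g x)%:E = 1)%E].

(* Derivatives are total functions in the library, so equilibria are required
   to be twice differentiable: then all derivatives in Q g are genuine (the
   convolutions with g are smooth). *)
Definition equilibrium (R : realType) (c : model_case) (gamma kappa zeta : R)
    (g : R -> R) : Prop :=
  [/\ probability_density g,
      forall x, derivable g x 1 /\ derivable (derive1 g) x 1 &
      forall x, Q c gamma kappa zeta g x = 0].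

Definition solution (R : realType) (n : nat) (c : model_case)
    (gamma kappa zeta D e : R) (u : phase_fun R n) : Prop :=
  [/\ regular u,
      forall a p t, 0 <= t -> 0 <= u a p t &
      forall a p t, 0 <= t ->
        time_derive (u a p) t + Rterm c gamma kappa zeta D u a p t =
        (e ^+ 2)^-1 * Q c gamma kappa zeta (fun q => u a q t) p].

Definition C_s (R : realType) (gamma kappa zeta D : R) : R :=
  gamma * D *
  (zeta ^+ 3 / (2 * sigma Symmetric kappa zeta ^+ 2 + zeta ^+ 2) `^ (3 / 2)).

Definition C_a (R : realType) (gamma kappa zeta D : R) : R :=
  gamma * D *
  (zeta ^+ 2 / (sigma NonSymmetric kappa zeta ^+ 2 + zeta ^+ 2)).

(* Main.v *)
Require Import Defs.
From HB Require Import structures.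
From mathcomp Require Import all_boot all_order all_algebra.
From mathcomp Require Import all_classical all_reals all_analysis.
From mathcomp Require Import measurable_realfun ring lra.

(* Write f_eps = f + eps^2 f1 + o(eps^2).  Every quantity in the equation is a
   rational expression in f, its derivatives and their convolutions, so the order
   eps^-2 and eps^0 terms of the equation read, pointwise,
       Q(f) = 0   and   d_t f + R(f) = Q'(f) f1.
   The first one makes f a local equilibrium rho F_{sigma, phi}; the smoothness of
   rho and phi where rho > 0 is inherited from ln f, a quadratic polynomial in the
   opinion.  In the second one everything but d_t rho F is the derivative of a
   flux that decays in the opinion, so d_t rho = 0 and the flux vanishes
   identically.  The equation for rho phi follows by integrating the vanishing flux
   against a weight for which the contribution of f1 cancels: the weight 1 in the
   symmetric case, where opinion is conserved, and the weight G * f in the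
   non-symmetric case, where it is not.  What remains is a Gaussian integral. *)

Set Implicit Arguments.
Unset Strict Implicit.
Unset Printing Implicit Defensive.

Import Order.TTheory GRing.Theory Num.Theory.
Import numFieldNormedType.Exports.
Local Open Scope classical_set_scope.
Local Open Scope ring_scope.

(** * Rules of differentiation *)

(** Write [A g] and [B g] for the convolutions of [x G] and [G] with [g]. The weight [B f] of the
    non-symmetric case comes from the equation that determines [sigma]: at equilibrium drift and
    diffusion balance, [A f / B f * f = - kappa / 2 * f']. Multiplied by [B f], the linearized flux
    loses its denominators, and an integration by parts leaves a multiple of the integral of
    [A f1 * f + A f * f1]. This is zero because [x G] is odd. In the symmetric case the weight 1
    leads to the same sum.

    Two obstacles shape the rest. The expansion is known for [eps > 0] only, and time derivatives
    are one-sided at [t = 0]; in both cases the function is continued across the boundary by a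
    tangent line, after which ordinary calculus applies. Moreover [d_t rho = 0] is claimed also
    where [rho = 0], where the mean opinion is undetermined and, in the non-symmetric case, the
    fluxes divide by zero. There it follows from the other times: at a fixed position, positive mass
    has zero time derivative, and the mass is small near every time at which it vanishes. *)

Section derive_rules.
Context {R : realType} {V : normedModType R}.
Implicit Types (f g : V -> R) (h : R -> R) (x v : V) (a b : R).

Lemma is_derive_add f g x v a b : is_derive x v f a -> is_derive x v g b ->
  is_derive x v (fun y => f y + g y) (a + b).
Proof. by move=> fa gb; apply: is_deriveD. Qed.

Lemma is_derive_sub f g x v a b : is_derive x v f a -> is_derive x v g b ->
  is_derive x v (fun y => f y - g y) (a - b).
Proof. by move=> fa gb; apply: is_deriveB. Qed.

Lemma is_derive_opp f x v a : is_derive x v f a ->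
  is_derive x v (fun y => - f y) (- a).
Proof. by move=> fa; exact: is_deriveN. Qed.

Lemma is_derive_mul f g x v a b : is_derive x v f a -> is_derive x v g b ->
  is_derive x v (fun y => f y * g y) (f x * b + g x * a).
Proof. by move=> fa gb; exact: is_deriveM. Qed.

(** Restricting to the line through [x] along [v] turns a directional derivative into a derivative
    on [R], so that the one-variable chain rule also serves positions. *)
Lemma is_derive_line f x v a :
  is_derive x v f a <-> is_derive (0 : R) (1 : R) (fun s : R => f (s *: v + x)) a.
Proof.
have E : 'D_v f x = 'D_(1 : R) (fun s : R => f (s *: v + x)) 0.
  rewrite /derive; set F1 := fun _ => _; set F2 := fun _ => _.
  suff -> : F1 = F2 by [].
  apply/funext => s; rewrite /F1 /F2 /=.
  by rewrite addr0 scale0r add0r [_%:A]mulr1.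
have [h1 h2] := derivable1P (f : V -> R^o) x v.
split=> -[df dfa].
  by constructor; [exact: h1|rewrite -E].
by constructor; [exact: h2|rewrite E].
Qed.

Lemma is_derive_comp h f x v a b : is_derive (f x) (1 : R) h b ->
  is_derive x v f a -> is_derive x v (fun y => h (f y)) (b * a).
Proof.
move=> hb /is_derive_line fa; apply/is_derive_line.
by apply: (@is_derive1_comp _ h); rewrite //= scale0r add0r.
Qed.

Lemma is_derive_inv f x v a : f x != 0 -> is_derive x v f a ->
  is_derive x v (fun y => (f y)^-1) (- (f x) ^- 2 * a).
Proof.
move=> fx0 fa; apply: (is_derive_comp (h := fun y => y^-1)) => //.
have -> : - (f x) ^- 2 = - (f x) ^- 2 *: (1 : R) :> R by rewrite [RHS]mulr1.
exact: (is_deriveV (f := id)).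
Qed.

Lemma is_derive_expR f x v a : is_derive x v f a ->
  is_derive x v (fun y => expR (f y)) (expR (f x) * a).
Proof. by move=> fa; apply: (is_derive_comp (h := expR)). Qed.

Lemma is_derive_ln f x v a : 0 < f x -> is_derive x v f a ->
  is_derive x v (fun y => ln (f y)) ((f x)^-1 * a).
Proof. by move=> fx fa; apply: (is_derive_comp (h := @ln R)) => //; exact: is_derive1_ln. Qed.

Lemma is_derive_sqr f x v a : is_derive x v f a ->
  is_derive x v (fun y => f y ^+ 2) (2 * f x * a).
Proof.
move=> fa; have -> : 2 * f x * a = f x * a + f x * a by ring.
exact: is_derive_mul.
Qed.

Lemma is_derive_unique f x v a b : is_derive x v f a -> is_derive x v f b -> a = b.
Proof. by move=> [_ <-] [_ <-]. Qed.

End derive_rules.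

(** Differentiates an expression by its structure. The derivative may be an existential variable, so
    the same steps also prove mere differentiability; [der] leaves the equation between the computed
    and the claimed derivative. Nonvanishing and positivity conditions are sought in the context. *)
Ltac der_step :=
  first
   [ assumption
   | apply: is_derive_cst
   | lazymatch goal with
     | |- is_derive _ _ (fun y => _ + - _) _ => eapply is_derive_sub
     | |- is_derive _ _ (fun y => _ + _) _ => eapply is_derive_add
     | |- is_derive _ _ (fun y => - _) _ => eapply is_derive_opp
     | |- is_derive _ _ (fun y => _ * _) _ => eapply is_derive_mul
     | |- is_derive _ _ (fun y => _ ^+ 2) _ => eapply is_derive_sqr
     | |- is_derive _ _ (fun y => _ ^-1) _ => eapply is_derive_inv
     | |- is_derive _ _ (fun y => expR _) _ => eapply is_derive_expR
     | |- is_derive _ _ (fun y => ln _) _ => eapply is_derive_ln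
     | |- is_derive _ _ (fun y => y) _ => apply: is_derive_id
     end
   | solve [eauto 2] ].
Ltac der := eapply is_derive_eq; [repeat der_step | cbv beta].

Section derive1D.
Context {R : realType}.
Implicit Types (f g : R -> R) (x a b : R).

Lemma is_derive_continuous f x a : is_derive x (1 : R) f a -> {for x, continuous f}.
Proof.
by case=> /derivable1_diffP df _; exact: differentiable_continuous.
Qed.

Lemma is_derive_derive1 f x a : is_derive x (1 : R) f a -> derive1 f x = a.
Proof. by rewrite derive1E => -[]. Qed.

End derive1D.

(** * Decaying functions *)

(** The class in which integrals over the opinion are taken. It is stable under products with
    [bounded_continuous] functions, which is what convolutions with the kernels are. *)
Definition decaying (R : realType) (g : R -> R) : Prop :=
  continuous g /\ forall m : nat, exists C : R, forall x, `|x| ^+ m * `|g x| <= C.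

Definition bounded_continuous (R : realType) (g : R -> R) : Prop :=
  continuous g /\ exists C : R, forall x, `|g x| <= C.

Section decaying.
Context {R : realType}.
Implicit Types (f g h K : R -> R) (x c : R).
Local Notation mu := (@lebesgue_measure R).

Lemma decaying_bounded g : decaying g -> bounded_continuous g.
Proof.
by move=> [cg /(_ 0%N)[C gC]]; split => //; exists C => x;
  have := gC x; rewrite expr0 mul1r.
Qed.

Lemma decayingD f g : decaying f -> decaying g -> decaying (fun x => f x + g x).
Proof.
move=> [cf df] [cg dg]; split; first by move=> x; exact: cvgD (cf x) (cg x).
move=> m; have [C fC] := df m; have [E gE] := dg m; exists (C + E) => x.
apply: le_trans (lerD (fC x) (gE x)).
by rewrite -mulrDr ler_wpM2l ?exprn_ge0// ler_normD.
Qed.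

Lemma decayingM f g : bounded_continuous f -> decaying g ->
  decaying (fun x => f x * g x).
Proof.
move=> [cf [C fC]] [cg dg]; split; first by move=> x; exact: cvgM (cf x) (cg x).
move=> m; have [E gE] := dg m; exists (C * E) => x.
by rewrite normrM mulrCA ler_pM// mulr_ge0// exprn_ge0.
Qed.

Lemma bounded_continuous_cst c : bounded_continuous (fun _ => c).
Proof. by split; [move=> x; exact: cvg_cst|exists `|c|]. Qed.

Lemma decayingZ c g : decaying g -> decaying (fun x => c * g x).
Proof. by move=> dg; apply: decayingM dg; exact: bounded_continuous_cst. Qed.

Lemma decayingN g : decaying g -> decaying (fun x => - g x).
Proof.
by move=> /(decayingZ (-1)); congr decaying; apply/funext => x; rewrite mulN1r.
Qed.

Lemma decayingB f g : decaying f -> decaying g -> decaying (fun x => f x - g x).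
Proof. by move=> df dg; apply: decayingD => //; exact: decayingN. Qed.

Lemma decaying_mulX c g : decaying g -> decaying (fun x => (x - c) * g x).
Proof.
move=> dg; have -> : (fun x => (x - c) * g x) = (fun x => x * g x - c * g x).
  by apply/funext => x; ring.
apply: decayingB; last exact: decayingZ.
move: dg => [cg dg]; split.
  by move=> x; apply: cvgM (cg x); exact: cvg_id.
move=> m; have [C gC] := dg m.+1; exists C => x.
by rewrite normrM mulrA -exprSr.
Qed.

(** The common majorant: it gives integrability of decaying functions, and later it controls
    remainders well enough to convolve them. *)
Lemma integrable_oneDsqrV : mu.-integrable setT (EFin \o (fun x : R => (oneDsqr x)^-1)).
Proof.
have m1 : measurable_fun setT (fun x : R => (oneDsqr x)^-1).
  by apply: continuous_measurable_fun; exact: continuous_oneDsqrV.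
apply/integrableP; split; first exact/measurable_EFinP.
under eq_integral do rewrite /= ger0_norm ?invr_ge0//.
rewrite ge0_symfun_integralT//.
- by rewrite -set_itvcy integral0y_oneDsqr ltry.
- exact: continuous_oneDsqrV.
- by move=> x /=; rewrite /oneDsqr sqrrN.
Qed.

Lemma decaying_oneDsqrV g : decaying g ->
  exists2 C, 0 <= C & forall x, `|g x| <= C * (oneDsqr x)^-1.
Proof.
move=> [_ dg]; have [C gC] := dg 0%N; have [E gE] := dg 2%N.
exists (C + E).
  rewrite addr_ge0//.
    by apply: le_trans (gC 0); rewrite mulr_ge0.
  by apply: le_trans (gE 0); rewrite mulr_ge0// exprn_ge0.
move=> x; rewrite ler_pdivlMr ?oneDsqr_gt0// /oneDsqr mulrC mulrDl mul1r lerD//.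
  by have := gC x; rewrite expr0 mul1r.
by have := gE x; rewrite -normrX ger0_norm// sqr_ge0.
Qed.

Lemma decaying_integrable g : decaying g -> mu.-integrable setT (EFin \o g).
Proof.
move=> dg; have [C C0 gC] := decaying_oneDsqrV dg.
have := integrableZl measurableT C integrable_oneDsqrV.
apply: le_integrable => //.
  apply/measurable_EFinP; apply: continuous_measurable_fun.
  by case: dg.
move=> x _ /=; rewrite lee_fin (le_trans (gC x))// ler_norm//.
Qed.

Lemma decaying_cvgy g : decaying g -> g x @[x --> +oo] --> 0.
Proof.
move=> [_ /(_ 1%N)[C gC]]; apply/cvgrPdist_le => e e0.
near=> x; rewrite sub0r normrN.
have x0 : 0 < x by near: x; exact: nbhs_pinfty_gt.
rewrite -(ler_pM2l x0); have := gC x; rewrite expr1 (gtr0_norm x0) => /le_trans.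
apply; rewrite -ler_pdivrMr//; near: x; exact: nbhs_pinfty_ge.
Unshelve. all: by end_near. Qed.

Lemma decaying_comp_opp g : decaying g -> decaying (fun x => g (- x)).
Proof.
move=> [cg dg]; split.
  by move=> x; apply: (cvg_comp _ _ (@cvgN _ _ _ _ _ _ _ cvg_id)); exact: cg.
by move=> m; have [C gC] := dg m; exists C => x; rewrite -normrN.
Qed.

Lemma decaying_cvgNy g : decaying g -> g x @[x --> -oo] --> 0.
Proof.
by move=> /decaying_comp_opp/decaying_cvgy ?; exact/cvgNy_compNP.
Qed.

End decaying.

(** * Integration over the real line *)

Section integral.
Context {R : realType}.
Implicit Types (f g h K : R -> R) (x c : R).
Local Notation mu := (@lebesgue_measure R).

Lemma cvg_integral_symmetric_itv h : mu.-integrable setT (EFin \o h) ->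
  (\int[mu]_(x in `[(- n%:R)%R, (n%:R)%R]) (h x)%:E)%E @[n --> \oo] -->
  (\int[mu]_x (h x)%:E)%E.
Proof.
move=> ih.
under eq_fun do rewrite integral_mkcond.
have mh : measurable_fun setT (EFin \o h) by exact: measurable_int ih.
have I n : measurable (`[- n%:R, n%:R]%classic : set R) by exact: measurable_itv.
have [|||||_ _] := @dominated_convergence _ _ _ mu setT measurableT
  (fun n => (EFin \o h) \_ `[- n%:R, n%:R]) (EFin \o h) (abse \o (EFin \o h)); last exact.
- by move=> n; apply/(measurable_restrictT _ _).1 => //; exact: measurable_funTS.
- exact: mh.
- apply: aeW => x _; apply: cvg_near_cst; near=> n.
  rewrite patchE mem_set//= in_itv/= -ler_norml; near: n.
  exact: nbhs_infty_ger.
- exact: integrable_abse.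
- apply: aeW => x n _; rewrite patchE; case: ifP => // _.
  by rewrite abse0 abse_ge0.
Unshelve. all: by end_near. Qed.

(** Fundamental theorem of calculus on [[-n, n]]: the boundary values tend to zero, and the
    integrals tend to the one over the line by dominated convergence. *)
Lemma integral_derive0 h h' : decaying h -> decaying h' ->
  (forall x, is_derive x (1 : R) h (h' x)) -> \int[mu]_x h' x = 0.
Proof.
move=> dh dh' hh'.
have ih' := decaying_integrable dh'.
rewrite /Rintegral.
suff -> : (\int[mu]_x (h' x)%:E = 0)%E by [].
have /cvg_lim <- // := cvg_integral_symmetric_itv ih'.
apply/cvg_lim => //.
have E n : (0 < n)%N -> (\int[mu]_(x in `[(- n%:R)%R, (n%:R)%R]) (h' x)%:E =
    (h n%:R - h (- n%:R))%R%:E)%E.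
  move=> n0; rewrite (@continuous_FTC2 _ h' h)//.
  - by rewrite gtrN// ltr0n.
  - by apply: continuous_subspaceT; case: dh'.
  - split; first by move=> x _; case: (hh' x).
      by apply: cvg_at_right_filter; exact: (is_derive_continuous (hh' _)).
    by apply: cvg_at_left_filter; exact: (is_derive_continuous (hh' _)).
  - by move=> x _; exact: is_derive_derive1.
have : {near \oo, (fun n => (h n%:R - h (- n%:R))%:E) =1
    (fun n => \int[mu]_(x in `[(- n%:R)%R, (n%:R)%R]) (h' x)%:E)%E}.
  by near=> n; rewrite E//; near: n; exists 1%N.
move/near_eq_cvg/cvg_trans; apply.
apply: cvg_EFin; first exact: nearW.
rewrite /comp/= -[X in _ --> X](subrr 0).
apply: cvgB.
  by apply: (cvg_comp _ _ (@cvgr_idn R)); exact: decaying_cvgy.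
apply: (cvg_comp (fun n : nat => n%:R) (fun x => h (- x)) (@cvgr_idn R)).
by apply: decaying_cvgy; exact: decaying_comp_opp.
Unshelve. all: by end_near. Qed.

(** A derivative of constant sign makes [W] monotone, and a monotone function with limit 0 at both
    ends is 0. Hence [k * w = 0], and [k = 0] since [w] is positive. *)
Lemma eq0_of_derive_sign (W w : R -> R) (k : R) :
  W x @[x --> +oo] --> 0 -> W x @[x --> -oo] --> 0 ->
  (forall x, is_derive x (1 : R) W (k * w x)) -> (forall x, 0 < w x) ->
  k = 0 /\ forall x, W x = 0.
Proof.
wlog k0 : W k / 0 <= k => [wlg|] Wy WNy dW w0.
  have [/wlg|k0] := leP 0 k; first exact.
  have [|||||/eqP Nk0 NW0] := wlg (fun x => - W x) (- k).
  - by rewrite oppr_ge0 ltW.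
  - by rewrite -oppr0; exact: cvgN.
  - by rewrite -oppr0; exact: cvgN.
  - by move=> x; der; ring.
  - exact: w0.
  split; first by apply/eqP; rewrite -oppr_eq0.
  by move=> x; apply/eqP; rewrite -oppr_eq0 NW0.
have W0 x : W x = 0.
  have mono a b : a <= b -> W a <= W b.
    move=> ab.
    have [|c cab E] := @MVT_segment _ W (fun x => k * w x) a b ab (fun y _ => dW y).
      by apply: continuous_subspaceT => y; exact: is_derive_continuous (dW y).
    by rewrite -subr_ge0 E !mulr_ge0 ?subr_ge0// ltW.
  apply/eqP; rewrite eq_le; apply/andP; split.
    apply: (cvgr_to_ge Wy).
    by apply: filterS (nbhs_pinfty_ge (num_real x)) => y; exact: mono.
  apply: (cvgr_to_le WNy).
  by apply: filterS (nbhs_ninfty_le (num_real x)) => y; exact: mono.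
split=> //.
have : k * w 0 = 0.
  apply: (is_derive_unique (dW 0)).
  have -> : W = cst 0 by apply/funext => x; exact: W0.
  exact: is_derive_cst.
by move/eqP; rewrite mulf_eq0 (gt_eqF (w0 0)) orbF => /eqP.
Qed.

End integral.

(** * Convolution *)

Section convolution.
Context {R : realType}.
Implicit Types (f g h K : R -> R) (x c : R).
Local Notation mu := (@lebesgue_measure R).

Lemma decaying_norm g : decaying g -> decaying (fun x => `|g x|).
Proof.
move=> [cg dg]; split; first by move=> x; exact: cvg_norm (cg x).
by move=> m; have [C gC] := dg m; exists C => x; rewrite normr_id.
Qed.

Lemma EFin_Rintegral g : decaying g ->
  (\int[mu]_x (g x)%:E)%E = (\int[mu]_x g x)%:E.
Proof.
move=> dg; rewrite /Rintegral fineK//; apply: integrable_fin_num => //.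
exact: decaying_integrable.
Qed.

Lemma RintegralD_decaying f g : decaying f -> decaying g ->
  \int[mu]_x (f x + g x) = \int[mu]_x f x + \int[mu]_x g x.
Proof. by move=> df dg; apply: RintegralD => //; exact: decaying_integrable. Qed.

Lemma RintegralB_decaying f g : decaying f -> decaying g ->
  \int[mu]_x (f x - g x) = \int[mu]_x f x - \int[mu]_x g x.
Proof. by move=> df dg; apply: RintegralB => //; exact: decaying_integrable. Qed.

Lemma RintegralZ_decaying c g : decaying g ->
  \int[mu]_x (c * g x) = c * \int[mu]_x g x.
Proof. by move=> dg; apply: RintegralZl => //; exact: decaying_integrable. Qed.

Lemma bounded_continuous_reflect K x : bounded_continuous K ->
  bounded_continuous (fun y => K (x - y)).
Proof.
move=> [cK [M KM]]; split; last by exists M.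
move=> y; apply: (cvg_comp (fun y => x - y) K); last exact: cK.
by apply: cvgB; [exact: cvg_cst|exact: cvg_id].
Qed.

Lemma decaying_integrand K g x : bounded_continuous K -> decaying g ->
  decaying (fun y => K (x - y) * g y).
Proof.
by move=> bK dg; apply: decayingM dg; exact: bounded_continuous_reflect.
Qed.

Lemma convolution_lin K f g c x : bounded_continuous K -> decaying f -> decaying g ->
  convolution K (fun y => f y + c * g y) x = convolution K f x + c * convolution K g x.
Proof.
move=> bK df dg; rewrite /convolution -RintegralZ_decaying; last exact: decaying_integrand.
rewrite -RintegralD_decaying; [|exact: decaying_integrand|].
  by apply: eq_Rintegral => y _; ring.
exact/decayingZ/decaying_integrand.
Qed.

Lemma le_norm_convolution K g x M : bounded_continuous K -> decaying g ->
  (forall y, `|K y| <= M) ->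
  `|convolution K g x| <= M * \int[mu]_y `|g y|.
Proof.
move=> bK dg KM; have di := decaying_integrand x bK dg.
rewrite -RintegralZ_decaying; last exact: decaying_norm.
apply: le_trans (le_normr_Rintegral _ _) _ => //; first exact: decaying_integrable.
apply: le_Rintegral => //.
- exact/decaying_integrable/decaying_norm.
- exact/decaying_integrable/decayingZ/decaying_norm.
- by move=> y _; rewrite normrM ler_wpM2r.
Qed.

Lemma is_derive_convolution K K' g x :
  bounded_continuous K -> bounded_continuous K' ->
  (forall y, is_derive y (1 : R) K (K' y)) -> decaying g ->
  is_derive x (1 : R) (convolution K g) (convolution K' g x).
Proof.
move=> bK [cK' [M K'M]] dK dg.
have M0 : 0 <= M by apply: le_trans (K'M 0).
pose F (x y : R) := K (x - y) * g y.
have dF u y : is_derive u (1 : R) (F ^~ y) (K' (u - y) * g y).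
  rewrite /F.
  have d1 : is_derive u (1 : R) (fun u => K (u - y)) (K' (u - y) * 1).
    apply: (is_derive_comp (h := K) (f := fun u => u - y)).
    by der; ring.
  by der; ring.
have E : partial1of2 F = fun x y => K' (x - y) * g y.
  by apply/funext => u; apply/funext => y; exact: is_derive_derive1.
pose Gd y := M * `|g y|.
have xI : `](x - 1), (x + 1)[%classic x.
  by rewrite /= in_itv/= ltrBlDr ltrDl ltr01.
have iF u : `](x - 1), (x + 1)[%classic u -> mu.-integrable setT (EFin \o F u).
  by move=> _; exact/decaying_integrable/decaying_integrand.
have dF' u y : `](x - 1), (x + 1)[%classic u -> setT y -> derivable (F ^~ y) u 1.
  by move=> _ _; case: (dF u y).
have G0 y : 0 <= Gd y by rewrite mulr_ge0.
have iG : mu.-integrable setT (EFin \o Gd).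
  exact/decaying_integrable/decayingZ/decaying_norm.
have ub u y : `](x - 1), (x + 1)[%classic u -> setT y ->
    `|partial1of2 F u y| <= Gd y.
  by move=> _ _; rewrite E normrM ler_wpM2r.
have := derivable_under_integral measurableT xI iF dF' G0 iG ub.
have := differentiation_under_integral measurableT xI iF dF' G0 iG ub.
by rewrite E derive1E /convolution => <- /derivableP.
Qed.

Lemma bounded_continuous_convolution K K' g :
  bounded_continuous K -> bounded_continuous K' ->
  (forall y, is_derive y (1 : R) K (K' y)) -> decaying g ->
  bounded_continuous (convolution K g).
Proof.
move=> bK bK' dK dg; split.
  by move=> x; exact: is_derive_continuous (is_derive_convolution x bK bK' dK dg).
have [_ [M KM]] := bK; exists (M * \int[mu]_y `|g y|) => x.
exact: le_norm_convolution.
Qed.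

(** Fubini's theorem, exchanging the two opinions; [s] records the parity of the kernel. *)
Lemma convolution_adjoint K K' g h (s : R) :
  bounded_continuous K -> bounded_continuous K' ->
  (forall y, is_derive y (1 : R) K (K' y)) -> decaying g -> decaying h -> (forall y, K (- y) = s * K y) ->
  \int[mu]_x (convolution K g x * h x) = s * \int[mu]_x (convolution K h x * g x).
Proof.
move=> bK bK' dK dg dh sK.
pose F (z : R * R) := (K (z.1 - z.2) * g z.2 * h z.1)%:E.
have mF : measurable_fun setT F.
  apply/measurable_EFinP; apply: measurable_funM.
    apply: measurable_funM.
      apply: measurableT_comp.
        by apply: continuous_measurable_fun; case: bK.
      exact: measurable_funB.
    apply: measurableT_comp => //.
    by apply: continuous_measurable_fun; case: dg.
  apply: measurableT_comp => //.
  by apply: continuous_measurable_fun; case: dh.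
have dF x : decaying (fun y => K (x - y) * g y * h x).
  have -> : (fun y => K (x - y) * g y * h x) = (fun y => h x * (K (x - y) * g y)).
    by apply/funext => y; rewrite mulrC.
  exact/decayingZ/decaying_integrand.
have F1 x : (\int[mu]_y F (x, y))%E = (convolution K g x * h x)%:E.
  rewrite /F /= EFin_Rintegral//; congr EFin.
  rewrite [RHS]mulrC -RintegralZ_decaying; last exact: decaying_integrand.
  by apply: eq_Rintegral => y _; rewrite mulrC.
have F2 y : (\int[mu]_x F (x, y))%E = (s * (convolution K h y * g y))%:E.
  have E : (fun x => K (x - y) * g y * h x) = (fun x => s * g y * (K (y - x) * h x)).
    apply/funext => x; rewrite -opprB sK.
    by ring.
  have dKh : decaying (fun x => K (y - x) * h x) by exact: decaying_integrand.
  rewrite /F /= EFin_Rintegral E; last exact: decayingZ.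
  by congr EFin; rewrite RintegralZ_decaying// -mulrA [convolution _ _ _ * _]mulrC.
have iF : (mu \x mu)%E.-integrable setT F.
  have [_ [M KM]] := bK.
  apply/integrable12ltyP => //.
  pose C := M * \int[mu]_y `|g y|.
  apply: (@le_lt_trans _ _ (\int[mu]_x (C * `|h x|)%:E)%E); last first.
    by rewrite EFin_Rintegral ?ltry//; exact/decayingZ/decaying_norm.
  apply: ge0_le_integral => //=.
  - by move=> x _; exact: integral_ge0.
  - apply: (@measurable_fun_fubini_tonelli_F _ _ _ _ _ mu (abse \o F)) => //.
      exact: measurableT_comp.
    by move=> z; exact: abse_ge0.
  - apply/measurable_EFinP; apply: continuous_measurable_fun; exact: (decayingZ C (decaying_norm dh)).1.
  move=> x _; rewrite EFin_Rintegral; last exact: decaying_norm (dF x).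
  rewrite lee_fin /C -mulrA [X in M * X]mulrC mulrA.
  rewrite -RintegralZ_decaying; last exact: decaying_norm.
  apply: le_Rintegral => //.
  - exact/decaying_integrable/decaying_norm.
  - exact/decaying_integrable/decayingZ/decaying_norm.
  - move=> y _; rewrite !normrM mulrAC ler_wpM2r// ler_wpM2r//.
have := Fubini iF.
under eq_integral do rewrite F1.
under [in RHS]eq_integral do rewrite F2.
move=> /(congr1 fine); rewrite -/(Rintegral _ _ _) -/(Rintegral _ _ _) => ->.
apply: RintegralZ_decaying; apply: decayingM => //.
exact: bounded_continuous_convolution bK' dK dh.
Qed.

End convolution.

(** * Gaussians *)

Definition gaussian (R : realType) (v x : R) : R := expR (- x ^+ 2 / (2 * v)).

Section gaussian.
Context {R : realType}.
Implicit Types (f g h K : R -> R) (x c v w m : R).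
Local Notation mu := (@lebesgue_measure R).

Lemma gaussian_gt0 v x : 0 < gaussian v x.
Proof. exact: expR_gt0. Qed.

Lemma is_derive_gaussian v c x : v != 0 ->
  is_derive x (1 : R) (fun y => gaussian v (y - c))
    (- ((x - c) / v) * gaussian v (x - c)).
Proof.
move=> v0; rewrite /gaussian.
by der; field.
Qed.

Lemma decaying_mul_monomial g (k : nat) : decaying g -> decaying (fun x => x ^+ k * g x).
Proof.
elim: k => [|k IH] dg.
  by move: dg; congr decaying; apply/funext => x; rewrite expr0 mul1r.
have := decaying_mulX 0 (IH dg); congr decaying; apply/funext => x.
by rewrite subr0 exprS mulrA.
Qed.

(** Induction on the weight, for all [g] at once: [|x| <= |x - c| + |c|] trades one power of the
    weight for the decaying function [x * g x]. *)
Lemma decaying_shift g c : decaying g -> decaying (fun x => g (x - c)).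
Proof.
move=> dg; split.
  move=> x; apply: (cvg_comp (fun y => y - c) g); last by case: dg => + _; exact.
  by apply: cvgB; [exact: cvg_id|exact: cvg_cst].
move=> k; elim: k g dg => [|k IH] g dg.
  by have [_ /(_ 0%N)[C gC]] := dg; exists C => x; have := gC (x - c); rewrite !expr0.
have [C1 g1] := IH _ (decaying_mulX 0 dg); have [C2 g2] := IH _ dg.
exists (C1 + `|c| * C2) => x.
have := lerD (g1 x) (ler_wpM2l (normr_ge0 c) (g2 x)).
rewrite subr0 normrM; apply: le_trans.
rewrite exprSr; set A := _ ^+ k; set B := `|g _|; set d := `|x - c|.
have -> : A * (d * B) + `|c| * (A * B) = A * (d + `|c|) * B by ring.
apply: ler_wpM2r; first exact: normr_ge0.
apply: ler_wpM2l; first by rewrite exprn_ge0.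
by rewrite -{1}(subrK c x) ler_normD.
Qed.

Lemma decaying_gaussian v : 0 < v -> decaying (gaussian v).
Proof.
move=> v0; split.
  move=> x; have := @is_derive_gaussian v 0 x (lt0r_neq0 v0).
  by move=> /is_derive_continuous; congr (continuous_at _ _);
    apply/funext => y; rewrite subr0.
(* From [y <= exp y] at [y = x ^ 2 / (2 v k)], raised to the power [k]. Even weights are enough,
   since [|x| ^ k <= 1 + x ^ (2 k)]. *)
have bound (k : nat) x : x ^+ (2 * k) * gaussian v x <= (2 * v * k%:R) ^+ k.
  have [->|k0] := eqVneq k 0%N.
    by rewrite muln0 !expr0 mul1r /gaussian -expR0 ler_expR mulNr oppr_le0
      divr_ge0 ?sqr_ge0// mulr_ge0// ltW.
  have k1 : 0 < k%:R :> R by rewrite ltr0n lt0n.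
  rewrite /gaussian exprM; set y := x ^+ 2.
  have -> : - y / (2 * v) = (- (y / (2 * v * k%:R))) * k%:R.
    by field; rewrite !gt_eqF.
  rewrite expRM_natr -exprMn lerXn2r ?nnegrE//.
  - by rewrite mulr_ge0 ?expR_ge0// sqr_ge0.
  - by rewrite !mulr_ge0// ltW.
  rewrite expRN ler_pdivrMr ?expR_gt0// -ler_pdivrMl ?mulr_gt0// mulrC.
  by apply: le_trans (expR_ge1Dx _); rewrite lerDr.
move=> k; exists ((2 * v * 0%:R) ^+ 0 + (2 * v * k%:R) ^+ k) => x.
rewrite (gtr0_norm (gaussian_gt0 v x)).
apply: le_trans (lerD (bound 0%N x) (bound k x)).
rewrite -mulrDl ler_wpM2r ?expR_ge0// muln0 expr0 exprM -normrX.
have [x1|x1] := lerP `|x| 1.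
  by rewrite normrX (@le_trans _ _ 1) ?exprn_ile1// lerDl exprn_ge0// sqr_ge0.
rewrite normrX -real_normK ?num_real// -exprM mulnC exprM expr2.
rewrite (@le_trans _ _ (`|x| ^+ k * `|x| ^+ k)) ?lerDr//.
by rewrite ler_peMr ?exprn_ge0// exprn_ege1// ltW.
Qed.

Lemma gaussianM v w x : 0 < v -> 0 < w ->
  gaussian v x * gaussian w x = gaussian (v * w / (v + w)) x.
Proof.
move=> v0 w0; rewrite /gaussian -expRD; congr expR.
by field; rewrite !gt_eqF//= addr_gt0.
Qed.

Lemma normal_pdf_gaussian m s x : s != 0 ->
  normal_pdf m s x = normal_peak s * gaussian (s ^+ 2) (x - m).
Proof.
by move=> s0; rewrite normal_pdfE// /normal_fun /gaussian mulr_natl.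
Qed.

Lemma normal_peak_sqrt v : 0 < v -> normal_peak (Num.sqrt v) = (Num.sqrt (2 * pi * v))^-1.
Proof.
move=> v0; rewrite /normal_peak sqr_sqrtr ?ltW//; congr (Num.sqrt _)^-1.
by rewrite -mulr_natr; ring.
Qed.

Lemma integral_gaussian v m : 0 < v ->
  \int[mu]_x gaussian v (x - m) = Num.sqrt (2 * pi * v).
Proof.
move=> v0; have s0 : Num.sqrt v != 0 by rewrite gt_eqF// sqrtr_gt0.
have := integral_normal_pdf m (Num.sqrt v).
have -> : (fun x => (normal_pdf m (Num.sqrt v) x)%:E) =
    (fun x => ((Num.sqrt (2 * pi * v))^-1 * gaussian v (x - m))%:E).
  apply/funext => x; rewrite normal_pdf_gaussian//.
  by rewrite normal_peak_sqrt// sqr_sqrtr// ltW.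
have dg := decaying_shift m (decaying_gaussian v0).
rewrite EFin_Rintegral; last exact: decayingZ.
rewrite RintegralZ_decaying// => -[] /(canRL (mulKf _)) ->.
  by rewrite invrK mulr1.
by rewrite invr_eq0 gt_eqF// sqrtr_gt0 !mulr_gt0// pi_gt0.
Qed.

(** Each identity integrates an exact derivative, by [g' = - (x - m) / v * g]; the primitives are
    multiples of [g], [(x - m) g] and [(x - m) ^ 2 g]. *)
Lemma integral_gaussian_moments v m : 0 < v ->
  [/\ \int[mu]_x ((x - m) * gaussian v (x - m)) = 0,
      \int[mu]_x ((x - m) ^+ 2 * gaussian v (x - m)) = v * \int[mu]_x gaussian v (x - m) &
      \int[mu]_x ((x - m) ^+ 3 * gaussian v (x - m)) = 0].
Proof.
move=> v0; have vn0 : v != 0 by rewrite gt_eqF.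
pose g x := gaussian v (x - m).
have d0 : decaying g by exact/decaying_shift/decaying_gaussian.
have dk k : decaying (fun x => (x - m) ^+ k * g x).
  exact: (decaying_shift m (decaying_mul_monomial k (decaying_gaussian v0))).
have dg x : is_derive x (1 : R) g (- ((x - m) / v) * g x) by exact: is_derive_gaussian.
have d1 : decaying (fun x => (x - m) * g x) by exact: decaying_mulX.
have M1 : \int[mu]_x ((x - m) * g x) = 0.
  apply: (@integral_derive0 _ (fun x => - v * g x)) => //.
    exact: decayingZ.
  by move=> x; der; field.
have M2 : \int[mu]_x (g x - v^-1 * ((x - m) ^+ 2 * g x)) = 0.
  apply: (@integral_derive0 _ (fun x => (x - m) * g x)) => //.
    by apply: decayingB => //; exact: decayingZ.
  by move=> x; der; field.
have M3 : \int[mu]_x ((2 * v) * ((x - m) * g x) - (x - m) ^+ 3 * g x) = 0.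
  apply: (@integral_derive0 _ (fun x => v * ((x - m) ^+ 2 * g x))).
  - exact: decayingZ.
  - by apply: decayingB => //; exact: decayingZ.
  by move=> x; der; field.
split=> //.
  move: M2; rewrite RintegralB_decaying//; last exact: decayingZ.
  rewrite RintegralZ_decaying// => /eqP; rewrite subr_eq0 => /eqP ->.
  by rewrite mulrA divff// mul1r.
move: M3; rewrite RintegralB_decaying//; last exact: decayingZ.
by rewrite RintegralZ_decaying// M1 mulr0 sub0r => /eqP; rewrite oppr_eq0 => /eqP.
Qed.

End gaussian.

(** * Convolution with the interaction kernels *)

Definition sqG (R : realType) (zeta x : R) : R := x ^+ 2 * G zeta x.

Section kernels.
Context {R : realType} (zeta : R).
Hypothesis zeta0 : 0 < zeta.
Implicit Types (f g h K : R -> R) (x c v w m : R).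
Local Notation mu := (@lebesgue_measure R).
Local Notation A := (convolution (idG zeta)).
Local Notation B := (convolution (G zeta)).
Local Notation C := (convolution (sqG zeta)).

(** Near a point of positive value, continuity keeps [g] above half that value on an interval, which
    contributes a positive amount to the integral. *)
Lemma integral_eq0_decaying g : decaying g -> (forall x, 0 <= g x) ->
  \int[mu]_x g x = 0 -> forall x, g x = 0.
Proof.
move=> dg g0 ig x0; apply/eqP; rewrite eq_le g0 andbT leNgt; apply/negP => gx0.
have [e e0 ge] : exists2 e, 0 < e & forall y, `|y - x0| <= e -> g x0 / 2 < g y.
  have : \forall y \near x0, g x0 / 2 < g y.
    have /cvgr_gt := dg.1 x0; apply.
    by rewrite ltr_pdivrMr// ltr_pMr// ltr1n.
  move=> /nbhs_ballP[e /= e0 eg]; exists (e / 2); first exact: divr_gt0.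
  move=> y yd; apply: eg; rewrite /ball /= distrC.
  by apply: le_lt_trans yd _; rewrite ltr_pdivrMr// ltr_pMr// ltr1n.
have mI : measurable (`[x0 - e, x0 + e]%classic : set R) by exact: measurable_itv.
have : (\int[mu]_(x in `[(x0 - e)%R, (x0 + e)%R]) (g x0 / 2)%:E <= \int[mu]_x (g x)%:E)%E.
  apply: (@le_trans _ _ (\int[mu]_(x in `[(x0 - e)%R, (x0 + e)%R]) (g x)%:E)%E).
    apply: ge0_le_integral => //=.
    - by move=> y _; rewrite lee_fin divr_ge0.
    - apply/measurable_EFinP; apply: measurable_funTS.
      by apply: continuous_measurable_fun; case: dg.
    - move=> y; rewrite in_itv/= => /andP[y1 y2]; rewrite lee_fin ltW// ge//.
      by rewrite ler_norml lerBrDl y1 lerBlDl y2.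
  apply: ge0_subset_integral => //=.
    by apply/measurable_EFinP; apply: continuous_measurable_fun; case: dg.
  by move=> y _; rewrite lee_fin.
rewrite EFin_Rintegral// ig integral_cst//= lebesgue_measure_itv/=
  lte_fin ltrD2l gtrN// -EFinD -EFinM lee_fin leNgt => /negP; apply.
by rewrite mulr_gt0 ?divr_gt0// opprB addrC addrA subrK addr_gt0.
Qed.

Lemma zeta_sqr_gt0 : 0 < zeta ^+ 2.
Proof. exact: exprn_gt0. Qed.

Lemma decaying_G : decaying (G zeta).
Proof. exact: (decaying_gaussian zeta_sqr_gt0). Qed.

Lemma bounded_G : bounded_continuous (G zeta).
Proof. exact: decaying_bounded decaying_G. Qed.

Lemma bounded_idG : bounded_continuous (idG zeta).
Proof. exact: decaying_bounded (decaying_mul_monomial 1 decaying_G). Qed.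

Lemma bounded_sqG : bounded_continuous (sqG zeta).
Proof. exact: decaying_bounded (decaying_mul_monomial 2 decaying_G). Qed.

Lemma bounded_continuousD f g : bounded_continuous f -> bounded_continuous g ->
  bounded_continuous (fun x => f x + g x).
Proof.
move=> [cf [M fM]] [cg [N gN]]; split; first by move=> x; exact: cvgD (cf x) (cg x).
by exists (M + N) => x; apply: le_trans (ler_normD _ _) (lerD (fM x) (gN x)).
Qed.

Lemma bounded_continuousM f g : bounded_continuous f -> bounded_continuous g ->
  bounded_continuous (fun x => f x * g x).
Proof.
move=> [cf [M fM]] [cg [N gN]]; split; first by move=> x; exact: cvgM (cf x) (cg x).
by exists (M * N) => x; rewrite normrM ler_pM.
Qed.

Lemma bounded_continuousZ c g : bounded_continuous g ->
  bounded_continuous (fun x => c * g x).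
Proof. by move=> bg; apply: bounded_continuousM => //; exact: bounded_continuous_cst. Qed.

Lemma convolution_kernel_lin K K' g c x : bounded_continuous K ->
  bounded_continuous K' -> decaying g ->
  convolution (fun y => K y + c * K' y) g x = convolution K g x + c * convolution K' g x.
Proof.
move=> bK bK' dg.
rewrite /convolution -RintegralZ_decaying; last exact: decaying_integrand.
rewrite -RintegralD_decaying; [|exact: decaying_integrand|].
  by apply: eq_Rintegral => y _; ring.
exact/decayingZ/decaying_integrand.
Qed.

Lemma is_derive_G x : is_derive x (1 : R) (G zeta) (- (zeta ^+ 2)^-1 * idG zeta x).
Proof.
have := @is_derive_gaussian _ (zeta ^+ 2) 0 x (lt0r_neq0 zeta_sqr_gt0).
have -> : (fun y => gaussian (zeta ^+ 2) (y - 0)) = G zeta.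
  by apply/funext => y; rewrite subr0.
move=> dG; eapply is_derive_eq; first exact: dG.
by rewrite /idG /G /gaussian subr0; field; rewrite gt_eqF.
Qed.

Lemma is_derive_idG x : is_derive x (1 : R) (idG zeta)
  (G zeta x + - (zeta ^+ 2)^-1 * sqG zeta x).
Proof. by have dG := is_derive_G; rewrite /idG /sqG; der; rewrite /idG; ring. Qed.

Lemma is_derive_convolution_G g x : decaying g ->
  is_derive x (1 : R) (B g) (- (zeta ^+ 2)^-1 * A g x).
Proof.
move=> dg; eapply is_derive_eq.
  apply: is_derive_convolution bounded_G _ is_derive_G dg.
  exact/bounded_continuousZ/bounded_idG.
rewrite /convolution -RintegralZ_decaying; last exact: (decaying_integrand _ bounded_idG).
by apply: eq_Rintegral => y _; ring.
Qed.

Lemma is_derive_convolution_idG g x : decaying g ->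
  is_derive x (1 : R) (A g) (B g x - (zeta ^+ 2)^-1 * C g x).
Proof.
move=> dg; eapply is_derive_eq.
  apply: is_derive_convolution bounded_idG _ is_derive_idG dg.
  apply: bounded_continuousD bounded_G _.
  exact: (bounded_continuousZ _ bounded_sqG).
rewrite -mulNr; apply: convolution_kernel_lin => //.
- exact: bounded_G.
- exact: bounded_sqG.
Qed.

Lemma bounded_convolution_G g : decaying g -> bounded_continuous (B g).
Proof.
move=> dg; apply: bounded_continuous_convolution bounded_G _ is_derive_G dg.
exact/bounded_continuousZ/bounded_idG.
Qed.

Lemma bounded_convolution_idG g : decaying g -> bounded_continuous (A g).
Proof.
move=> dg; apply: bounded_continuous_convolution bounded_idG _ is_derive_idG dg.
apply: bounded_continuousD bounded_G _.
exact: (bounded_continuousZ _ bounded_sqG).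
Qed.

(** Antisymmetry, because [x G] is odd. This is the cancellation that removes [f1] from the balance
    of momentum. *)
Lemma integral_convolution_idG g h : decaying g -> decaying h ->
  \int[mu]_x (A g x * h x) = - \int[mu]_x (A h x * g x).
Proof.
move=> dg dh; rewrite -mulN1r.
apply: convolution_adjoint bounded_idG _ is_derive_idG dg dh _.
  apply: bounded_continuousD bounded_G _.
  exact: (bounded_continuousZ _ bounded_sqG).
by move=> y; rewrite mulN1r /idG /G sqrrN mulNr.
Qed.

(** Completing the square: in the variable [y] the integrand is a Gaussian of variance
    [v zeta ^ 2 / (v + zeta ^ 2)] and mean [(v x + zeta ^ 2 m) / (v + zeta ^ 2)], times a factor
    free of [y]. *)
Lemma convolution_G_gaussian v m x : 0 < v ->
  B (fun y => gaussian v (y - m)) x =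
  Num.sqrt (2 * pi * (v * zeta ^+ 2 / (v + zeta ^+ 2))) *
  gaussian (v + zeta ^+ 2) (x - m).
Proof.
move=> v0; have z0 := zeta_sqr_gt0; have vz0 := addr_gt0 v0 z0.
have w0 : 0 < v * zeta ^+ 2 / (v + zeta ^+ 2) by rewrite divr_gt0// mulr_gt0.
rewrite -(integral_gaussian ((v * x + zeta ^+ 2 * m) / (v + zeta ^+ 2)) w0) mulrC.
rewrite -RintegralZ_decaying; last exact/decaying_shift/decaying_gaussian.
apply: eq_Rintegral => y _; rewrite /G /gaussian -!expRD; congr expR.
by field; rewrite !gt_eqF.
Qed.

(** Obtained without a new integral: [B g] is explicit, and its derivative is
    [- zeta ^ -2 * A g]. *)
Lemma convolution_idG_gaussian v m x : 0 < v ->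
  A (fun y => gaussian v (y - m)) x =
  zeta ^+ 2 / (v + zeta ^+ 2) * (x - m) * B (fun y => gaussian v (y - m)) x.
Proof.
move=> v0; have z0 := zeta_sqr_gt0; have vz0 := addr_gt0 v0 z0.
have dg := decaying_shift m (decaying_gaussian v0).
have d1 := is_derive_convolution_G x dg.
have E : B (fun y => gaussian v (y - m)) = fun x =>
  Num.sqrt (2 * pi * (v * zeta ^+ 2 / (v + zeta ^+ 2))) * gaussian (v + zeta ^+ 2) (x - m).
  by apply/funext => y; exact: convolution_G_gaussian.
move: d1; rewrite E => d1; have d3 := @is_derive_gaussian _ (v + zeta ^+ 2) m x (lt0r_neq0 vz0).
have d2 : is_derive x (1 : R) (fun x => Num.sqrt (2 * pi * (v * zeta ^+ 2 / (v + zeta ^+ 2)))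
  * gaussian (v + zeta ^+ 2) (x - m)) (Num.sqrt (2 * pi * (v * zeta ^+ 2 / (v + zeta ^+ 2)))
  * (- ((x - m) / (v + zeta ^+ 2)) * gaussian (v + zeta ^+ 2) (x - m))).
  by der; ring.
have := is_derive_unique d1 d2.
rewrite mulNr => /(canRL opprK); rewrite mulrC => /(canRL (mulfVK (lt0r_neq0 z0))) ->.
by field; rewrite gt_eqF.
Qed.

Lemma convolution_scale K g c x : bounded_continuous K -> decaying g ->
  convolution K (fun y => c * g y) x = c * convolution K g x.
Proof.
move=> bK dg; rewrite /convolution -RintegralZ_decaying; last exact: decaying_integrand.
by apply: eq_Rintegral => y _; ring.
Qed.

End kernels.

(** * Collision and interaction fluxes *)

Section rates.
Context {R : realType}.
Implicit Types z kappa a b c g : R.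

(* [z] stands for [zeta ^- 2]; [a], [b], [c] are the convolutions of the kernels
   [x G], [G], [x^2 G] with [g], and [ah], [bh], [ch] those with another function;
   [g1] and [g2] are the derivatives of [g]. *)
Definition sym_rate z kappa (ah bh ch : R) g g1 g2 :=
  (1 - kappa / 2 * z) * ((bh - z * ch) * g + ah * g1)
  + kappa / 2 * (bh * g2 - z * ah * g1).

Definition nonsym_rate z kappa a b c g g1 g2 :=
  ((b - z * c) / b + z * a ^+ 2 / b ^+ 2) * g + a / b * g1 + kappa / 2 * g2.

Definition nonsym_birate z a b c (ah bh ch : R) g g1 :=
  ((bh - z * ch) / b + z * a * ah / b ^+ 2) * g + ah / b * g1
  - ((b - z * c) / b ^+ 2 + 2 * z * a ^+ 2 / (b * b ^+ 2)) * g * bh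
  - a / b ^+ 2 * g1 * bh + z * a / b ^+ 2 * g * ah.

End rates.

Section fluxes.
Context {R : realType} (kappa zeta : R).
Hypothesis zeta0 : 0 < zeta.
Implicit Types (f g h K : R -> R) (x c v w m : R).
Local Notation mu := (@lebesgue_measure R).
Local Notation A := (convolution (idG zeta)).
Local Notation B := (convolution (G zeta)).
Local Notation C := (convolution (sqG zeta)).
Local Notation z := ((zeta ^+ 2)^-1).

(** The flux [A h * g + kappa / 2 * (B h * g)'] with the derivative of [B h] expanded. Taking
    [h = g] gives the flux of [Q], and taking for [h] the Laplacian gives that of the interaction
    term. *)
Definition sym_flux h g g1 x :=
  (1 - kappa / 2 * z) * (A h x * g x) + kappa / 2 * (B h x * g1 x).

(** First variation of [A g / B g * g] when only the convolved copies of [g] move, in the direction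
    [h]. It therefore occurs both in the interaction term and in the linearized collision
    operator. *)
Definition nonsym_flux h g x :=
  A h x / B g x * g x - A g x / B g x ^+ 2 * g x * B h x.

Variables (g g1 g2 h : R -> R).
Hypotheses (dg : decaying g) (dh : decaying h).
Hypothesis gg1 : forall x, is_derive x (1 : R) g (g1 x).
Hypothesis g1g2 : forall x, is_derive x (1 : R) g1 (g2 x).

Lemma is_derive_sym_flux x : is_derive x (1 : R) (sym_flux h g g1)
  (sym_rate z kappa (A h x) (B h x) (C h x) (g x) (g1 x) (g2 x)).
Proof.
have dA := is_derive_convolution_idG zeta0 x dh.
have dB := is_derive_convolution_G zeta0 x dh.
have := gg1 x; have := g1g2 x => ? ?.
by rewrite /sym_flux; der; rewrite /sym_rate; ring.
Qed.

Lemma sym_flux_derive1 p :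
  derive1 (fun q => A h q * g q + kappa / 2 * derive1 (fun s => B h s * g s) q) p =
  sym_rate z kappa (A h p) (B h p) (C h p) (g p) (g1 p) (g2 p).
Proof.
rewrite -(is_derive_derive1 (is_derive_sym_flux p)); congr (derive1 _ p).
apply/funext => q; have dB := is_derive_convolution_G zeta0 q dh.
rewrite (is_derive_derive1 (is_derive_mul dB (gg1 q))) /sym_flux.
by ring.
Qed.

Lemma is_derive_nonsym_flux x : B g x != 0 ->
  is_derive x (1 : R) (nonsym_flux h g)
  (nonsym_birate z (A g x) (B g x) (C g x) (A h x) (B h x) (C h x) (g x) (g1 x)).
Proof.
move=> B0; have dA := is_derive_convolution_idG zeta0 x dh.
have dB := is_derive_convolution_G zeta0 x dh.
have dAg := is_derive_convolution_idG zeta0 x dg.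
have dBg := is_derive_convolution_G zeta0 x dg.
have B20 : B g x ^+ 2 != 0 by rewrite expf_neq0.
have := gg1 x => ?.
rewrite /nonsym_flux; der; rewrite /nonsym_birate; field.
by rewrite B0 gt_eqF.
Qed.

Lemma near_convolution_neq0 p : B g p != 0 -> \forall q \near p, B g q != 0.
Proof.
move=> B0; have cB := is_derive_continuous (is_derive_convolution_G zeta0 p dg).
by have /cvgr_neq0 := cB; apply.
Qed.

Lemma is_derive_nonsym_Qflux x : B g x != 0 ->
  is_derive x (1 : R) (fun q => A g q / B g q * g q + kappa / 2 * g1 q)
  (nonsym_rate z kappa (A g x) (B g x) (C g x) (g x) (g1 x) (g2 x)).
Proof.
move=> B0; have dAg := is_derive_convolution_idG zeta0 x dg.
have dBg := is_derive_convolution_G zeta0 x dg.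
have := gg1 x; have := g1g2 x => ? ?.
der; rewrite /nonsym_rate; field.
by rewrite B0 gt_eqF.
Qed.

Lemma nonsym_Qflux_derive1 p : B g p != 0 ->
  derive1 (fun q => A g q / B g q * g q +
     kappa / 2 * derive1 (fun s => B g s / B g s * g s) q) p =
  nonsym_rate z kappa (A g p) (B g p) (C g p) (g p) (g1 p) (g2 p).
Proof.
move=> B0; apply: is_derive_derive1.
(* [B g s / B g s] simplifies only where [B g] does not vanish, so the inner derivative is
   identified on a neighbourhood of [p]. *)
apply: near_eq_is_derive (is_derive_nonsym_Qflux B0).
apply: filterS (near_join (near_convolution_neq0 B0)) => q Bq.
congr (_ + _ * _); apply/esym/is_derive_derive1.
apply: near_eq_is_derive (gg1 q).
by apply: filterS Bq => s Bs; rewrite divff// mul1r.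
Qed.

End fluxes.

(** * Pointwise formulas for the collision and interaction terms *)

Section rate_formulas.
Context {R : realType} (gamma kappa zeta : R).
Hypothesis zeta0 : 0 < zeta.
Local Notation A := (convolution (idG zeta)).
Local Notation B := (convolution (G zeta)).
Local Notation C := (convolution (sqG zeta)).
Local Notation z := ((zeta ^+ 2)^-1).

(** The value of [Q] at one opinion depends on six numbers only. Once each of them is expanded in
    [eps ^ 2], the asymptotics of [Q] is a matter of the chain rule. *)
Definition Q_rate (c : model_case) (a b k g g1 g2 : R) :=
  match c with
  | Symmetric => gamma * sym_rate z kappa a b k g g1 g2
  | NonSymmetric => gamma * nonsym_rate z kappa a b k g g1 g2
  end.

Lemma Q_rateE c (g g1 g2 : R -> R) p : decaying g ->
  (forall x, is_derive x (1 : R) g (g1 x)) ->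
  (forall x, is_derive x (1 : R) g1 (g2 x)) ->
  H c (B g p) != 0 ->
  Q c gamma kappa zeta g p =
  Q_rate c (A g p) (B g p) (C g p) (g p) (g1 p) (g2 p).
Proof.
move=> dg gg1 g1g2; case: c => /= [_|B0]; last first.
  by rewrite /Q /= (nonsym_Qflux_derive1 kappa zeta0 dg gg1 g1g2 B0).
rewrite /Q /= -(sym_flux_derive1 kappa zeta0 dg gg1 g1g2).
apply: (congr1 (fun F : R -> R => gamma * derive1 F p)).
apply/funext => q; rewrite divr1.
apply: (congr1 (fun F : R -> R => A g q * g q + kappa / 2 * derive1 F q)).
by apply/funext => s; rewrite divr1.
Qed.

Definition R_rate (D : R) (c : model_case) (a b k ah bh ch g g1 g2 : R) :=
  match c with
  | Symmetric => - gamma * D * sym_rate z kappa ah bh ch g g1 g2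
  | NonSymmetric => - gamma * D * nonsym_birate z a b k ah bh ch g g1
  end.

Lemma R_rateE n c D (u : phase_fun R n) a t (g g1 g2 h : R -> R) p :
  (forall q, u a q t = g q) ->
  (forall q, laplacian (fun b => u b q t) a = h q) ->
  decaying g -> decaying h ->
  (forall x, is_derive x (1 : R) g (g1 x)) ->
  (forall x, is_derive x (1 : R) g1 (g2 x)) ->
  H c (B g p) != 0 ->
  Rterm c gamma kappa zeta D u a p t =
  R_rate D c (A g p) (B g p) (C g p) (A h p) (B h p) (C h p) (g p) (g1 p) (g2 p).
Proof.
move=> ug uh dg dh gg1 g1g2.
have ug' : (fun q => u a q t) = g by apply/funext.
have {}uh : (fun q => laplacian (fun b => u b q t) a) = h by apply/funext.
rewrite /Rterm ug' uh; case: c => /= [_|B0].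
  rewrite -(sym_flux_derive1 kappa zeta0 dh gg1 g1g2).
  apply: (congr1 (fun F : R -> R => - gamma * D * derive1 F p)); apply/funext => q.
  rewrite ug; apply: (congr1 (fun F : R -> R => A h q * g q + kappa / 2 * derive1 F q)).
  by apply/funext => s; rewrite ug.
rewrite -(is_derive_derive1 (is_derive_nonsym_flux zeta0 dg dh gg1 B0)).
apply: (congr1 (fun F : R -> R => - gamma * D * derive1 F p)); apply/funext => q.
by rewrite ?ug.
Qed.

End rate_formulas.

(** * One-sided time derivatives and phase functions *)

Section time_derivative.
Context {R : realType}.
Implicit Types (g h : R -> R) (t l : R).

Lemma is_derive_quotientP h t l :
  is_derive t (1 : R) h l <-> time_quotient h t @ t^' --> l.
Proof.
split=> [/is_derive1_caratheodory[q [hq cq <-]]|hl].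
  apply: cvg_trans ((continuous_withinNx _ _).1 cq).
  apply: near_eq_cvg; near=> s; rewrite /time_quotient hq mulfK// subr_eq0.
  by near: s; exact: nbhs_dnbhs_neq.
apply/is_derive1_caratheodory.
exists (fun s => if s == t then l else time_quotient h t s); split.
- move=> s; case: eqVneq => [->|st]; first by rewrite !subrr mulr0.
  by rewrite /time_quotient divfK// subr_eq0.
- apply/continuous_withinNx; rewrite eqxx; apply: cvg_trans hl.
  apply: near_eq_cvg; near=> s; rewrite ifN//.
  by near: s; exact: nbhs_dnbhs_neq.
- by rewrite eqxx.
Unshelve. all: by end_near. Qed.

Lemma is_time_derive_of h g t l : 0 <= t -> is_derive t (1 : R) h l ->
  (\forall s \near t, 0 <= s -> g s = h s) -> is_time_derive g t l.
Proof.
move=> t0 /is_derive_quotientP hl gh; have gt := nbhs_singleton gh t0.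
apply/cvgrPdist_le => e e0; move/cvgrPdist_le : hl => /(_ e e0) hl.
suff : \forall s \near t^', 0 <= s -> `|l - time_quotient g t s| <= e by [].
near=> s => s0.
have gs : g s = h s by move: s0; near: s; exact: nbhs_dnbhs.
by rewrite /time_quotient gt gs; near: s.
Unshelve. all: by end_near. Qed.

Lemma is_time_derive_eq h g t l : 0 <= t -> is_derive t (1 : R) h l ->
  (forall s, 0 <= s -> g s = h s) -> is_time_derive g t l.
Proof.
move=> t0 hl gh; apply: (is_time_derive_of t0 hl).
by apply: (@filterE _ (nbhs t)) => s; exact: gh.
Qed.

(** Continuation to negative times by the tangent line at [t]. It transfers the rules for two-sided
    derivatives to derivatives within [[0, +oo[]. *)
Lemma is_time_derive_extension g t l : 0 <= t -> is_time_derive g t l ->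
  exists2 h, is_derive t (1 : R) h l & forall s, 0 <= s -> g s = h s.
Proof.
move=> t0 gl; pose h s := if 0 <= s then g s else g t + l * (s - t).
exists h; last by move=> s s0; rewrite /h s0.
apply/is_derive_quotientP/cvgrPdist_le => e e0.
move/cvgrPdist_le : gl => /(_ e e0) gl'.
have gl : \forall s \near t^', 0 <= s -> `|l - time_quotient g t s| <= e by [].
near=> s.
have st : s - t != 0 by rewrite subr_eq0; near: s; exact: nbhs_dnbhs_neq.
rewrite /time_quotient /h t0; case: ifPn => s0.
  by move: s0; near: s.
by rewrite addrAC subrr add0r mulfK// subrr normr0 ltW.
Unshelve. all: by end_near. Qed.

(** Two extensions of [g] agree at nonnegative times, in particular to the right of [t]; the limits
    of their quotients are compared there. *)
Lemma is_time_derive_unique g t l l' : 0 <= t ->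
  is_time_derive g t l -> is_time_derive g t l' -> l = l'.
Proof.
move=> t0 /(is_time_derive_extension t0)[h hl gh] /(is_time_derive_extension t0)[k kl gk].
have [_ hd] := hl; have [_ kd] := kl.
suff H : {near t^'+, time_quotient k t =1 time_quotient h t}.
  have hl' := (is_derive_quotientP _ _ _).1 hl.
  have kl' := (is_derive_quotientP _ _ _).1 kl.
  have hl2 : time_quotient h t @ t^'+ --> l.
    exact: cvg_dnbhs_at_right.
  have kl2 : time_quotient k t @ t^'+ --> l'.
    exact: cvg_dnbhs_at_right.
  apply: (cvg_unique _ hl2) => //.
  by apply: cvg_trans kl2; exact: near_eq_cvg.
near=> s.
have s0 : 0 <= s by rewrite (le_trans t0)// ltW.
by rewrite /time_quotient -!gh// -!gk.
Unshelve. all: by end_near. Qed.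

Lemma time_derive_val g t l : 0 <= t -> is_time_derive g t l -> time_derive g t = l.
Proof.
move=> t0 gl; apply: (is_time_derive_unique t0 _ gl).
suff : time_derivable g t by [].
by rewrite /time_derivable; apply/cvg_ex; exists l.
Qed.

Lemma is_time_derive_lin g h t l l' (c : R) : 0 <= t ->
  is_time_derive g t l -> is_time_derive h t l' ->
  is_time_derive (fun s => g s + c * h s) t (l + c * l').
Proof.
move=> t0 /(is_time_derive_extension t0)[g' gl gg'].
move=> /(is_time_derive_extension t0)[h' hl hh'].
have hd : is_derive t (1 : R) (fun s => g' s + c * h' s) (l + c * l').
  by der; ring.
by apply: (is_time_derive_eq t0 hd) => s s0; rewrite gg'// hh'.
Qed.

Lemma is_time_derive_continuous g t l : 0 <= t -> is_time_derive g t l ->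
  forall e, 0 < e -> \forall s \near t, 0 <= s -> `|g t - g s| <= e.
Proof.
move=> t0 /(is_time_derive_extension t0)[h hl gh] e e0.
have /cvgrPdist_le/(_ e e0) := is_derive_continuous hl.
by apply: filterS => s hs s0; rewrite !gh.
Qed.

End time_derivative.

Section phase_functions.
Context {R : realType} {n : nat}.
Implicit Types (u v w : phase_fun R n) (d : direction n) (k : seq (direction n)).

Definition is_pderive d u a p t (l : R) : Prop :=
  match d with
  | Position i => is_derive a (delta_mx 0 i) (fun b => u b p t) l
  | Opinion => is_derive p (1 : R) (fun q => u a q t) l
  | Time => is_time_derive (u a p) t l
  end.

Lemma pderivableP d u a p t : pderivable d u a p t ->
  is_pderive d u a p t (pderive d u a p t).
Proof.
case: d => [i|//|//] /=.
- by move=> ?; exact: derivableP.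
- by move=> ?; rewrite derive1E; exact: derivableP.
Qed.

Lemma is_pderive_pderivable d u a p t l : is_pderive d u a p t l ->
  pderivable d u a p t.
Proof.
case: d => [i|//|//] /=; try by case.
by move=> ul; rewrite /time_derivable; apply/cvg_ex; exists l.
Qed.

Lemma is_pderive_val d u a p t l : 0 <= t -> is_pderive d u a p t l ->
  pderive d u a p t = l.
Proof.
move=> t0; case: d => [i|//|//] /=.
- by case.
- exact: is_derive_derive1.
- exact: time_derive_val.
Qed.

Lemma is_pderive_ext d u v a p t l : 0 <= t ->
  (forall a p t, 0 <= t -> u a p t = v a p t) ->
  is_pderive d u a p t l -> is_pderive d v a p t l.
Proof.
move=> t0 uv; case: d => [i|//|//] /=.
- by congr is_derive; apply/funext => b; rewrite uv.
- by congr is_derive; apply/funext => b; rewrite uv.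
- move=> /(is_time_derive_extension t0)[h hl uh].
  by apply: (is_time_derive_eq t0 hl) => s s0; rewrite -uv// uh.
Qed.

Lemma pderive_ext d u v : (forall a p t, 0 <= t -> u a p t = v a p t) ->
  forall a p t, 0 <= t -> pderive d u a p t = pderive d v a p t.
Proof.
move=> uv a p t t0; case: d => [i|//|//] /=.
- by congr (partial i _ a); apply/funext => b; rewrite uv.
- by congr (derive1 _ p); apply/funext => b; rewrite uv.
- have E : forall s, 0 <= s -> time_quotient (u a p) t s = time_quotient (v a p) t s.
    by move=> s s0; rewrite /time_quotient !uv.
  have uv' : {near within [set s | 0 <= s] t^',
      time_quotient (u a p) t =1 time_quotient (v a p) t}.
    by apply: (@filterE _ (t^')) => s; exact: E.
  have vu' : {near within [set s | 0 <= s] t^',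
      time_quotient (v a p) t =1 time_quotient (u a p) t}.
    by apply: (@filterE _ (t^')) => s s0; rewrite /= E.
  rewrite /time_derive; congr (lim _).
  by rewrite eqEsubset; split; exact: near_eq_cvg.
Qed.

Lemma pderives_ext k u v : (forall a p t, 0 <= t -> u a p t = v a p t) ->
  forall a p t, 0 <= t -> pderives k u a p t = pderives k v a p t.
Proof. by elim: k => [//|d k IH] uv /=; apply: pderive_ext; exact: IH. Qed.

Lemma is_pderive_lin d u v c a p t l l' : 0 <= t ->
  is_pderive d u a p t l -> is_pderive d v a p t l' ->
  is_pderive d (fun a p t => u a p t + c * v a p t) a p t (l + c * l').
Proof.
move=> t0; case: d => [i|//|//] /= ul vl.
- by der; ring.
- by der; ring.
- exact: is_time_derive_lin.
Qed.

Definition all_pderivable u := forall k d a p t, 0 <= t ->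
  pderivable d (pderives k u) a p t.

Lemma pderives_lin u v c : all_pderivable u -> all_pderivable v ->
  forall k a p t, 0 <= t -> pderives k (fun a p t => u a p t + c * v a p t) a p t =
    pderives k u a p t + c * pderives k v a p t.
Proof.
move=> su sv; elim=> [//|d k IH] a p t t0 /=.
rewrite (pderive_ext d IH)//; apply: is_pderive_val => //.
by apply: is_pderive_lin => //; apply: pderivableP; [exact: su|exact: sv].
Qed.

Lemma all_pderivable_lin u v c : all_pderivable u -> all_pderivable v ->
  all_pderivable (fun a p t => u a p t + c * v a p t).
Proof.
move=> su sv k d a p t t0.
apply: (@is_pderive_pderivable _ _ _ _ _ (pderive d (pderives k u) a p t +
  c * pderive d (pderives k v) a p t)).
apply: (@is_pderive_ext _ (fun a p t => pderives k u a p t + c * pderives k v a p t)) => //.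
  by move=> *; rewrite pderives_lin.
by apply: is_pderive_lin => //; apply: pderivableP; [exact: su|exact: sv].
Qed.

Lemma smooth_all_pderivable u : smooth u -> all_pderivable u.
Proof. by move=> su k d a p t t0; have [_] := su k; exact. Qed.

Lemma smooth_is_pderive u k d a p t : smooth u -> 0 <= t ->
  is_pderive d (pderives k u) a p t (pderives (d :: k) u a p t).
Proof. by move=> su t0; apply: pderivableP; exact: smooth_all_pderivable. Qed.

Lemma regular_decaying u k a t : regular u -> 0 <= t ->
  decaying (fun p => pderives k u a p t).
Proof.
move=> [su du] t0; split.
  move=> p; have := smooth_is_pderive k Opinion a p su t0.
  exact: is_derive_continuous.
move=> m; have [C uC] := du (Num.max `|a| t) k m; exists C => p.
by apply: uC; rewrite ?t0 le_max lexx// orbT.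
Qed.

Lemma smooth_near_gt0 u a p t : smooth u -> 0 <= t -> 0 < u a p t ->
  \forall b \near a, 0 < u b p t.
Proof.
move=> su t0 u0; have [/subspace_continuousP/= cu _] := su [::].
have /cvgr_gt/(_ _ u0) ue := cu (a, p, t) t0.
have {}ue : \forall z \near (a, p, t), 0 <= z.2 -> 0 < u z.1.1 z.1.2 z.2 by [].
have c : (fun b : 'rV[R]_n => (b, p, t)) @ a --> (a, p, t).
  have cap : (fun b : 'rV[R]_n => (b, p)) @ a --> (a, p).
    by apply: (@cvg_pair _ _ _ (nbhs a) (nbhs a) (nbhs p)); [exact: cvg_id|exact: cvg_cst].
  by apply: (@cvg_pair _ _ _ (nbhs a) (nbhs (a, p)) (nbhs t)) => //; exact: cvg_cst.
exact: (@filterS _ (nbhs a) (nbhs_filter a) _ _ (fun b ub => ub t0) (c _ ue)).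
Qed.

End phase_functions.

(** * Expansions in powers of eps^2 *)

Section expansions.
Context {R : realType}.
Implicit Types (l d e x : R).
Local Notation mu := (@lebesgue_measure R).

(* [y e = y0 + e^2 y1 + o(e^2)], as differentiability at 0 with respect to [e^2],
   so that the rules of differential calculus apply. *)
Definition expands (y : R -> R) (y0 y1 : R) : Prop :=
  exists2 h : R -> R, is_derive (0 : R) (1 : R) h y1 &
    h 0 = y0 /\ forall e, 0 < e -> y e = h (e ^+ 2).

Lemma expandsP (y : R -> R) (y0 y1 : R) :
  (forall d, 0 < d -> \forall e \near 0^'+, `|y e - y0 - e ^+ 2 * y1| <= d * e ^+ 2) ->
  expands y y0 y1.
Proof.
(* With [x = e ^ 2], positive [x] carry the data; elsewhere the tangent line continues them. *)
move=> H; exists (fun x => if 0 < x then y (Num.sqrt x) else y0 + x * y1); last first.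
  split; first by rewrite ltxx mul0r addr0.
  by move=> e e0; rewrite exprn_gt0// sqrtr_sqr gtr0_norm.
apply/is_derive_quotientP/cvgrPdist_le => d d0.
have [r /= r0 Hr] := H d d0.
have r20 : 0 < r ^+ 2 by rewrite exprn_gt0.
near=> x; rewrite /time_quotient ltxx mul0r addr0 subr0.
have xn0 : x != 0 by near: x; exact: nbhs_dnbhs_neq.
case: ltP => [x0|_]; last by rewrite addrAC subrr add0r mulrC mulKf// subrr normr0 ltW.
have sx0 : 0 < Num.sqrt x by rewrite sqrtr_gt0.
have sr : `|0 - Num.sqrt x| < r.
  rewrite sub0r normrN gtr0_norm// -[ltRHS]gtr0_norm// -sqrtr_sqr.
  rewrite ltr_sqrt// -[ltLHS](@gtr0_norm _ x)// -[X in `|X|]subr0 distrC.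
  near: x; apply: nbhs_dnbhs; exists (r ^+ 2) => //.
have := Hr _ sr sx0; rewrite (sqr_sqrtr (ltW x0)) => Hx.
rewrite -(ler_pM2r x0) -[X in _ * X <= _](gtr0_norm x0) -normrM mulrBl divfK//.
have -> : y1 * x - (y (Num.sqrt x) - y0) = - (y (Num.sqrt x) - y0 - x * y1) by ring.
by rewrite normrN.
Unshelve. all: by end_near. Qed.

Lemma cvg_sqr0 : (fun e : R => e ^+ 2) @ 0^'+ --> (0 : R)^'.
Proof.
move=> P [r /= r0 Pr].
have r1 : 0 < Num.min r 1 by rewrite lt_min r0/=.
exists (Num.min r 1) => //= e /=; rewrite sub0r normrN => er e0.
apply: Pr; last by rewrite expf_neq0// gt_eqF.
rewrite /= sub0r normrN normrX expr2; move: er; rewrite gtr0_norm// lt_min => /andP[er e1].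
by rewrite (le_lt_trans _ er)// ger_pMl// ltW.
Qed.

Lemma is_derive_expansion (h : R -> R) l : is_derive (0 : R) (1 : R) h l ->
  (h (e ^+ 2) @[e --> 0^'+] --> h 0) /\
  ((h (e ^+ 2) - h 0) / e ^+ 2 @[e --> 0^'+] --> l).
Proof.
move=> hl; split.
  apply: (cvg_comp _ _ cvg_sqr0).
  exact: (continuous_withinNx _ _).1 (is_derive_continuous hl).
have := (is_derive_quotientP _ _ _).1 hl => hl'.
have := cvg_comp _ _ cvg_sqr0 hl'.
by rewrite /comp /time_quotient; under eq_fun do rewrite subr0.
Qed.

(** An expansion uniform in the opinion. The weight [1 + p ^ 2] on the remainder makes it
    integrable, so that the expansion passes through convolutions. *)
Definition family_expands (y : R -> R -> R) (y0 y1 : R -> R) : Prop :=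
  [/\ decaying y0, decaying y1, (\forall e \near 0^'+, decaying (y e)) &
    forall d, 0 < d -> \forall e \near 0^'+, forall p,
      oneDsqr p * `|y e p - y0 p - e ^+ 2 * y1 p| <= d * e ^+ 2].

Lemma family_expandsD y y0 y1 w w0 w1 :
  family_expands y y0 y1 -> family_expands w w0 w1 ->
  family_expands (fun e p => y e p + w e p) (fun p => y0 p + w0 p) (fun p => y1 p + w1 p).
Proof.
move=> [dy0 dy1 dy Y] [dw0 dw1 dw W]; split; try exact: decayingD.
  by apply: filterS2 dy dw => e; exact: decayingD.
move=> d d0; have d20 : 0 < d / 2 by rewrite divr_gt0.
apply: filterS2 (Y _ d20) (W _ d20) => e ye we p.
apply: (@le_trans _ _ (d / 2 * e ^+ 2 + d / 2 * e ^+ 2)); last first.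
  by rewrite -mulrDl -splitr.
apply: le_trans (lerD (ye p) (we p)); rewrite -mulrDr ler_pM2l ?oneDsqr_gt0//.
apply: le_trans (ler_normD _ _); rewrite le_eqVlt; apply/orP; left; apply/eqP.
by congr `|_|; ring.
Qed.

Lemma family_expands_sum (I : Type) (r : seq I) (y : I -> R -> R -> R) (y0 y1 : I -> R -> R) :
  (forall i, family_expands (y i) (y0 i) (y1 i)) ->
  family_expands (fun e p => \sum_(i <- r) y i e p) (fun p => \sum_(i <- r) y0 i p)
    (fun p => \sum_(i <- r) y1 i p).
Proof.
move=> H; elim: r => [|i r IH].
  under [X in family_expands X]eq_fun do under eq_fun do rewrite big_nil.
  under [X in family_expands _ X]eq_fun do rewrite big_nil.
  under [X in family_expands _ _ X]eq_fun do rewrite big_nil.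
  have d0 : decaying (fun _ : R => 0 : R).
    split; first by move=> x; exact: cvg_cst.
    by move=> m; exists 0 => x; rewrite normr0 mulr0.
  split=> //; first exact: nearW.
  move=> d d0'; apply: nearW => e p.
  by rewrite mulr0 !subrr normr0 mulr0 mulr_ge0 ?sqr_ge0// ltW.
under [X in family_expands X]eq_fun do under eq_fun do rewrite big_cons.
under [X in family_expands _ X]eq_fun do rewrite big_cons.
under [X in family_expands _ _ X]eq_fun do rewrite big_cons.
exact: family_expandsD.
Qed.

Lemma family_expands_value y y0 y1 p : family_expands y y0 y1 ->
  expands (y ^~ p) (y0 p) (y1 p).
Proof.
move=> [_ _ _ Y]; apply: expandsP => d /Y; apply: filterS => e /(_ p).
by apply: le_trans; rewrite ler_peMl// oneDsqr_ge1.
Qed.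

Lemma family_expands_convolution K y y0 y1 p : bounded_continuous K ->
  family_expands y y0 y1 ->
  expands (fun e => convolution K (y e) p) (convolution K y0 p) (convolution K y1 p).
Proof.
move=> bK [dy0 dy1 dy Y]; have [_ [M KM]] := bK.
have M0 : 0 <= M by apply: le_trans (KM 0).
pose I0 := \int[mu]_x (oneDsqr x)^-1.
have I00 : 0 <= I0 by apply: Rintegral_ge0 => x _; rewrite invr_ge0 (le_trans ler01)// oneDsqr_ge1.
(* Convolution multiplies the tolerance on the remainder by at most [M * I0]; the summand 1 keeps
   the divisor positive. *)
have MI : 0 < M * I0 + 1 by rewrite ltr_wpDl// mulr_ge0.
apply: expandsP => d d0.
apply: filterS2 dy (Y _ (divr_gt0 d0 MI)) => e dye ye.
have -> : convolution K (y e) p - convolution K y0 p - e ^+ 2 * convolution K y1 p =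
    convolution K (fun x => y e x + - 1 * y0 x + - e ^+ 2 * y1 x) p.
  rewrite !convolution_lin//; first by rewrite mulN1r mulNr.
  by apply: decayingD => //; exact: decayingZ.
set w := fun x => _.
have dw : decaying w by apply: decayingD; [apply: decayingD => //|]; exact: decayingZ.
apply: le_trans (le_norm_convolution p bK dw KM) _.
have : \int[mu]_x `|w x| <= d / (M * I0 + 1) * e ^+ 2 * I0.
  rewrite -RintegralZl//; last exact: integrable_oneDsqrV.
  apply: le_Rintegral => //.
  - exact/decaying_integrable/decaying_norm.
  - exact: (integrableZl measurableT _ integrable_oneDsqrV).
  - move=> x _; rewrite ler_pdivlMr ?oneDsqr_gt0// mulrC.
    by apply: le_trans (ye x); rewrite /w mulN1r mulNr.
move=> /(ler_wpM2l M0)/le_trans; apply.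
have -> : M * (d / (M * I0 + 1) * e ^+ 2 * I0) = d * e ^+ 2 * (M * I0 / (M * I0 + 1)).
  by field; rewrite gt_eqF.
apply: ler_piMr; first by rewrite mulr_ge0 ?sqr_ge0// ltW.
by rewrite ler_pdivrMr// mul1r lerDl.
Qed.

End expansions.

(** * Linearization of the pointwise formulas *)

Section rate_derivatives.
Context {R : realType} (gamma kappa zeta : R).
Local Notation z := ((zeta ^+ 2)^-1).

(* The linearization of the collision operator, in the direction of the function
   with data [a1], [b1], [k1], [w], [w1], [w2]. *)
Definition linear_rate (c : model_case) (a b k a1 b1 k1 g g1 g2 w w1 w2 : R) :=
  match c with
  | Symmetric => sym_rate z kappa a1 b1 k1 g g1 g2 + sym_rate z kappa a b k w w1 w2
  | NonSymmetric => nonsym_birate z a b k a1 b1 k1 g g1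
      + nonsym_rate z kappa a b k w w1 w2
  end.

Lemma is_derive_Q_rate c (a b k g g1 g2 : R -> R) (a' b' k' w w1 w2 x : R) :
  H c (b x) != 0 ->
  is_derive x (1 : R) a a' -> is_derive x (1 : R) b b' -> is_derive x (1 : R) k k' ->
  is_derive x (1 : R) g w -> is_derive x (1 : R) g1 w1 -> is_derive x (1 : R) g2 w2 ->
  is_derive x (1 : R) (fun s => Q_rate gamma kappa zeta c (a s) (b s) (k s) (g s) (g1 s) (g2 s))
    (gamma * linear_rate c (a x) (b x) (k x) a' b' k' (g x) (g1 x) (g2 x) w w1 w2).
Proof.
case: c => /= [_|b0] da db dk dg dg1 dg2.
  by rewrite /sym_rate; der; rewrite /sym_rate; ring.
have b20 : b x ^+ 2 != 0 by rewrite expf_neq0.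
rewrite /nonsym_rate; der; rewrite /nonsym_rate /nonsym_birate.
clear b20; move: (b x) b0 => bx b0.
by move: (zeta ^+ 2)^-1 => z'; field.
Qed.

(** The interaction term enters the limit at order 0 only: differentiability serves to get
    continuity, so the derivative stays existential. *)
Lemma derivable_R_rate D c (a b k ah bh ch g g1 g2 : R -> R) (a' b' k' ah' bh' ch' w w1 w2 x : R) :
  H c (b x) != 0 ->
  is_derive x (1 : R) a a' -> is_derive x (1 : R) b b' -> is_derive x (1 : R) k k' ->
  is_derive x (1 : R) ah ah' -> is_derive x (1 : R) bh bh' -> is_derive x (1 : R) ch ch' ->
  is_derive x (1 : R) g w -> is_derive x (1 : R) g1 w1 -> is_derive x (1 : R) g2 w2 ->
  exists l, is_derive x (1 : R) (fun s => R_rate gamma kappa zeta D c (a s) (b s) (k s)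
    (ah s) (bh s) (ch s) (g s) (g1 s) (g2 s)) l.
Proof.
case: c => /= [_|b0] da db dk dah dbh dch dg dg1 dg2.
  by eexists; rewrite /sym_rate; repeat der_step.
have b20 : b x ^+ 2 != 0 by rewrite expf_neq0.
have b30 : b x * b x ^+ 2 != 0 by rewrite mulf_neq0.
by eexists; rewrite /nonsym_birate; repeat der_step.
Qed.

End rate_derivatives.

(** * The collision and interaction terms of a regular function *)

Section regular_rates.
Context {R : realType} {n : nat} (gamma kappa zeta D : R) (c : model_case).
Hypothesis zeta0 : 0 < zeta.
Variables (u : phase_fun R n) (a : 'rV[R]_n) (t : R).
Hypotheses (ru : regular u) (t0 : 0 <= t).
Local Notation A := (convolution (idG zeta)).
Local Notation B := (convolution (G zeta)).
Local Notation C := (convolution (sqG zeta)).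

Definition lap p : R := \sum_(i < n) pderives [:: Position i; Position i] u a p t.

Lemma decaying_sum (I : Type) (r : seq I) (g : I -> R -> R) :
  (forall i, decaying (g i)) -> decaying (fun x => \sum_(i <- r) g i x).
Proof.
move=> dg; elim: r => [|i r IH].
  under eq_fun do rewrite big_nil.
  split; first by move=> x; exact: cvg_cst.
  by move=> m; exists 0 => x; rewrite normr0 mulr0.
by under eq_fun do rewrite big_cons; exact: decayingD.
Qed.

Lemma decaying_lap : decaying lap.
Proof. by apply: decaying_sum => i; exact: regular_decaying. Qed.

Lemma is_derive_opinion k p : is_derive p (1 : R) (fun q => pderives k u a q t)
  (pderives (Opinion :: k) u a p t).
Proof. by have [su _] := ru; exact: (smooth_is_pderive k Opinion). Qed.

Let g := fun q => u a q t.
Let g1 := fun q => pderives [:: Opinion] u a q t.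
Let g2 := fun q => pderives [:: Opinion; Opinion] u a q t.

Lemma regular_Q_rate p : H c (B g p) != 0 ->
  Q c gamma kappa zeta g p =
  Q_rate gamma kappa zeta c (A g p) (B g p) (C g p) (g p) (g1 p) (g2 p).
Proof.
apply: (@Q_rateE _ gamma kappa zeta zeta0 c g g1 g2 p (regular_decaying [::] a ru t0)).
- exact: (is_derive_opinion [::]).
- exact: (is_derive_opinion [:: Opinion]).
Qed.

Lemma regular_R_rate p : H c (B g p) != 0 ->
  Rterm c gamma kappa zeta D u a p t =
  R_rate gamma kappa zeta D c (A g p) (B g p) (C g p) (A lap p) (B lap p) (C lap p)
    (g p) (g1 p) (g2 p).
Proof.
have lapE q : laplacian (fun b => u b q t) a = lap q by [].
exact: (@R_rateE _ gamma kappa zeta zeta0 n c D u a t g g1 g2 lap p (fun=> erefl) lapE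
  (regular_decaying [::] a ru t0) decaying_lap
  (is_derive_opinion [::]) (is_derive_opinion [:: Opinion])).
Qed.

End regular_rates.

(** * The two leading orders of the kinetic equation *)

Section limit_equation.
Context {R : realType} {n : nat} (gamma kappa zeta D : R) (c : model_case).
Hypothesis zeta0 : 0 < zeta.
Variables (feps : R -> phase_fun R n) (f f1 : phase_fun R n).
Hypothesis hsol : \forall e \near 0^'+, solution c gamma kappa zeta D e (feps e).
Hypotheses (rf : regular f) (rf1 : regular f1).
Hypothesis hlim : littleo_eps2 (fun e a p t => feps e a p t - f a p t - e ^+ 2 * f1 a p t).
Local Notation A := (convolution (idG zeta)).
Local Notation B := (convolution (G zeta)).
Local Notation C := (convolution (sqG zeta)).

Lemma near_regular : \forall e \near 0^'+, regular (feps e).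
Proof. by apply: filterS hsol => e []. Qed.

Lemma pderives_remainder e k a p t : regular (feps e) -> 0 <= t ->
  pderives k (fun a p t => feps e a p t - f a p t - e ^+ 2 * f1 a p t) a p t =
  pderives k (feps e) a p t - pderives k f a p t - e ^+ 2 * pderives k f1 a p t.
Proof.
move=> re t0; have [se _] := re; have [sf _] := rf; have [sf1 _] := rf1.
have pe := smooth_all_pderivable se; have pf := smooth_all_pderivable sf.
have pf1 := smooth_all_pderivable sf1.
rewrite (@pderives_ext _ _ _ _ (fun a p t => (feps e a p t + - 1 * f a p t)
  + - e ^+ 2 * f1 a p t))//; last by move=> *; ring.
rewrite pderives_lin//; last exact: all_pderivable_lin.
by rewrite pderives_lin//; ring.
Qed.

(** The seminorms with weights 1 and [p ^ 2], each with half the tolerance, add up to the weight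
    [1 + p ^ 2]. *)
Lemma family_expands_pderives k a t : 0 <= t ->
  family_expands (fun e p => pderives k (feps e) a p t)
    (fun p => pderives k f a p t) (fun p => pderives k f1 a p t).
Proof.
move=> t0; split; [exact: regular_decaying|exact: regular_decaying| |].
  by apply: filterS near_regular => e re; exact: regular_decaying.
move=> d d0; have d20 : 0 < d / 2 by rewrite divr_gt0.
apply: filterS3 near_regular (hlim (Num.max `|a| t) k 0%N d20)
  (hlim (Num.max `|a| t) k 2%N d20) => e re h0 h2 p.
have ar : `|a| <= Num.max `|a| t by rewrite le_max lexx.
have tr : 0 <= t <= Num.max `|a| t by rewrite t0 le_max lexx orbT.
have := lerD (h0 a p t ar tr) (h2 a p t ar tr).
rewrite (pderives_remainder k a p re t0) -mulrDl -mulrDl -splitr.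
by rewrite expr0 -normrX ger0_norm ?sqr_ge0.
Qed.

Lemma time_derive_cvg a p t : 0 <= t ->
  time_derive (feps e a p) t @[e --> 0^'+] --> time_derive (f a p) t.
Proof.
move=> t0; have := family_expands_value p (family_expands_pderives [:: Time] a t0).
move=> [h /is_derive_expansion[hl _] [h0 hE]].
rewrite -[time_derive (f a p) t]/(pderives [:: Time] f a p t) -h0.
apply: cvg_trans hl; apply: near_eq_cvg.
by apply: filterS (nbhs_right_gt 0) => e e0; rewrite -hE.
Qed.

Lemma limit_ge0 a p t : 0 <= t -> 0 <= f a p t.
Proof.
move=> t0; have := family_expands_value p (family_expands_pderives [::] a t0).
move=> [h /is_derive_expansion[hl _] [h0 hE]]; move: hl; rewrite h0 => hl.
apply: (cvgr_to_ge hl).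
apply: filterS2 hsol (nbhs_right_gt 0) => e [_ fe0 _] e0.
by rewrite -hE//; exact: fe0.
Qed.

(** Multiplied by [e ^ 2], the equation reads [e ^ 2 * Se = Qe], where [Se] converges. So [Qe] tends
    to 0, which gives [Q f = 0]; then [Se] is the difference quotient of [Qe] at 0 in the variable
    [e ^ 2], and its limit is the derivative of the collision rate. *)
Lemma limit_equation a p t : 0 <= t -> H c (B (fun q => f a q t) p) != 0 ->
  let g := fun q => f a q t in
  let g1 := fun q => pderives [:: Opinion] f a q t in
  let g2 := fun q => pderives [:: Opinion; Opinion] f a q t in
  let w := fun q => f1 a q t in
  let w1 := fun q => pderives [:: Opinion] f1 a q t in
  let w2 := fun q => pderives [:: Opinion; Opinion] f1 a q t in
  let h := lap f a t in
  Q c gamma kappa zeta g p = 0 /\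
  time_derive (f a p) t + R_rate gamma kappa zeta D c (A g p) (B g p) (C g p)
      (A h p) (B h p) (C h p) (g p) (g1 p) (g2 p) =
    gamma * linear_rate kappa zeta c (A g p) (B g p) (C g p) (A w p) (B w p) (C w p)
      (g p) (g1 p) (g2 p) (w p) (w1 p) (w2 p).
Proof.
move=> t0 Bn0 g g1 g2 w w1 w2 h.
have Fg := family_expands_pderives [::] a t0.
have Fg1 := family_expands_pderives [:: Opinion] a t0.
have Fg2 := family_expands_pderives [:: Opinion; Opinion] a t0.
have Fh := family_expands_sum (index_enum 'I_n)
  (fun i => family_expands_pderives [:: Position i; Position i] a t0).
have bG := bounded_G zeta0; have bI := bounded_idG zeta0; have bS := bounded_sqG zeta0.
have [gh dg [gh0 ghE]] := family_expands_value p Fg.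
have [gh1 dg1 [gh10 gh1E]] := family_expands_value p Fg1.
have [gh2 dg2 [gh20 gh2E]] := family_expands_value p Fg2.
have [ag dag [ag0 agE]] := family_expands_convolution p bI Fg.
have [bg dbg [bg0 bgE]] := family_expands_convolution p bG Fg.
have [kg dkg [kg0 kgE]] := family_expands_convolution p bS Fg.
have [ah dah [ah0 ahE]] := family_expands_convolution p bI Fh.
have [bh dbh [bh0 bhE]] := family_expands_convolution p bG Fh.
have [kh dkh [kh0 khE]] := family_expands_convolution p bS Fh.
have bgn0 : H c (bg 0) != 0 by rewrite bg0.
have dQ := is_derive_Q_rate gamma kappa zeta bgn0 dag dbg dkg dg dg1 dg2.
have [l dR] := derivable_R_rate gamma kappa zeta D bgn0 dag dbg dkg dah dbh dkh dg dg1 dg2.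
have [Qcvg Qder] := is_derive_expansion dQ.
have [Rcvg _] := is_derive_expansion dR.
have nearB : \forall e \near 0^'+, H c (B (fun q => feps e a q t) p) != 0.
  case: (c) Bn0 => /= [_|Bn0]; first by apply: nearW => _; exact: oner_neq0.
  have [bgc _] := is_derive_expansion dbg.
  have /cvgr_neq0 : bg (e ^+ 2) @[e --> 0^'+] --> B g p by rewrite -bg0.
  move=> /(_ Bn0); apply: filterS2 (nbhs_right_gt 0) => e e0.
  by rewrite -bgE.
have QE : \forall e \near 0^'+, Q c gamma kappa zeta (fun q => feps e a q t) p =
    Q_rate gamma kappa zeta c (ag (e ^+ 2)) (bg (e ^+ 2)) (kg (e ^+ 2)) (gh (e ^+ 2))
      (gh1 (e ^+ 2)) (gh2 (e ^+ 2)).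
  apply: filterS3 near_regular nearB (nbhs_right_gt 0) => e re Be e0.
  rewrite -agE// -bgE// -kgE// -ghE// -gh1E// -gh2E//.
  exact: (regular_Q_rate gamma kappa zeta0 re t0 Be).
have RE : \forall e \near 0^'+, Rterm c gamma kappa zeta D (feps e) a p t =
    R_rate gamma kappa zeta D c (ag (e ^+ 2)) (bg (e ^+ 2)) (kg (e ^+ 2))
      (ah (e ^+ 2)) (bh (e ^+ 2)) (kh (e ^+ 2)) (gh (e ^+ 2))
      (gh1 (e ^+ 2)) (gh2 (e ^+ 2)).
  apply: filterS3 near_regular nearB (nbhs_right_gt 0) => e re Be e0.
  rewrite -agE// -bgE// -kgE// -ahE// -bhE// -khE// -ghE// -gh1E// -gh2E//.
  exact: (regular_R_rate gamma kappa D zeta0 re t0 Be).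
have Q0 : Q_rate gamma kappa zeta c (ag 0) (bg 0) (kg 0) (gh 0) (gh1 0) (gh2 0) =
    Q c gamma kappa zeta g p.
  rewrite ag0 bg0 kg0 gh0 gh10 gh20; apply/esym.
  exact: (regular_Q_rate gamma kappa zeta0 rf t0 Bn0).
set S := time_derive (f a p) t + _.
pose Qe e := Q_rate gamma kappa zeta c (ag (e ^+ 2)) (bg (e ^+ 2)) (kg (e ^+ 2))
  (gh (e ^+ 2)) (gh1 (e ^+ 2)) (gh2 (e ^+ 2)).
pose Se e := time_derive (feps e a p) t + R_rate gamma kappa zeta D c (ag (e ^+ 2))
  (bg (e ^+ 2)) (kg (e ^+ 2)) (ah (e ^+ 2)) (bh (e ^+ 2)) (kh (e ^+ 2)) (gh (e ^+ 2))
  (gh1 (e ^+ 2)) (gh2 (e ^+ 2)).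
have Scvg : Se e @[e --> 0^'+] --> S.
  apply: cvgD; first exact: time_derive_cvg.
  by move: Rcvg; rewrite ag0 bg0 kg0 ah0 bh0 kh0 gh0 gh10 gh20.
have SE : {near 0^'+, (fun e => e ^+ 2 * Se e) =1 Qe}.
  apply: filterS3 (filterI QE RE) hsol (nbhs_right_gt 0) => e [QEe REe] [_ _ sol] e0.
  have e20 : e ^+ 2 != 0 by rewrite expf_neq0// gt_eqF.
  rewrite /Se /Qe -QEe -REe; have -> := sol a p t t0; rewrite (mulVKf e20).
  reflexivity.
have Qf0 : Q c gamma kappa zeta g p = 0.
  rewrite -Q0; apply: (cvg_unique _ Qcvg) => //.
  have e20 : e ^+ 2 @[e --> (0:R)^'+] --> (0 : R).
    by move=> P /nbhs_dnbhs/cvg_sqr0.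
  have eS : e ^+ 2 * Se e @[e --> 0^'+] --> 0.
    have := cvgM e20 Scvg; rewrite mul0r; exact.
  exact: cvg_trans (near_eq_cvg SE) eS.
split=> //.
have -> : A g p = ag 0 by exact: esym ag0.
have -> : B g p = bg 0 by exact: esym bg0.
have -> : C g p = kg 0 by exact: esym kg0.
have -> : g p = gh 0 by exact: esym gh0.
have -> : g1 p = gh1 0 by exact: esym gh10.
have -> : g2 p = gh2 0 by exact: esym gh20.
apply: (cvg_unique _ Scvg) => //.
apply: cvg_trans Qder; apply: near_eq_cvg.
apply: filterS2 SE (nbhs_right_gt 0) => e SEe e0.
have e20 : e ^+ 2 != 0 by rewrite expf_neq0// gt_eqF.
by rewrite Q0 Qf0 subr0 -/(Qe e) -SEe mulrC (mulKf e20).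
Qed.

End limit_equation.

(** * Local equilibrium *)

Section sigma.
Context {R : realType} (c : model_case) (kappa zeta : R).
Hypotheses (kappa0 : 0 < kappa) (zeta0 : 0 < zeta) (hc : kappa_condition c kappa zeta).

Lemma sigma_sqr : 0 < sigma c kappa zeta /\ sigma c kappa zeta ^+ 2 =
  match c with
  | Symmetric => kappa * zeta ^+ 2 / (2 * (zeta ^+ 2 - kappa))
  | NonSymmetric => kappa * zeta ^+ 2 / (2 * zeta ^+ 2 - kappa)
  end.
Proof.
have z20 := zeta_sqr_gt0 zeta0; rewrite /sigma; case: c hc => /= kz.
  have d0 : 0 < zeta ^+ 2 - kappa by rewrite subr_gt0.
  have E : zeta ^+ 2 / (2 * (zeta ^+ 2 / kappa - 1)) =
      kappa * zeta ^+ 2 / (2 * (zeta ^+ 2 - kappa)).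
    by field; rewrite !gt_eqF.
  have s0 : 0 < kappa * zeta ^+ 2 / (2 * (zeta ^+ 2 - kappa)).
    by rewrite divr_gt0 ?mulr_gt0.
  by rewrite E sqrtr_gt0 sqr_sqrtr// ltW.
have d0 : 0 < 2 * zeta ^+ 2 - kappa by rewrite subr_gt0.
have E : zeta ^+ 2 / (2 * zeta ^+ 2 / kappa - 1) =
    kappa * zeta ^+ 2 / (2 * zeta ^+ 2 - kappa).
  by field; rewrite !gt_eqF.
have s0 : 0 < kappa * zeta ^+ 2 / (2 * zeta ^+ 2 - kappa).
  by rewrite divr_gt0 ?mulr_gt0.
by rewrite E sqrtr_gt0 sqr_sqrtr// ltW.
Qed.

End sigma.

(** * The normal density and its derivatives *)

Section normal.
Context {R : realType} (s : R).
Hypothesis s0 : 0 < s.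
Local Notation mu := (@lebesgue_measure R).
Local Notation v := (s ^+ 2).
Implicit Types m x : R.

Lemma normal_pdfG m : normal_pdf m s = fun x => normal_peak s * gaussian v (x - m).
Proof. by apply/funext => x; rewrite normal_pdf_gaussian// gt_eqF. Qed.

Lemma normal_pdf_gt0 m x : 0 < normal_pdf m s x.
Proof. by rewrite normal_pdfG mulr_gt0 ?expR_gt0 ?normal_peak_gt0 ?gt_eqF. Qed.

Lemma decaying_normal_pdf m : decaying (normal_pdf m s).
Proof.
rewrite normal_pdfG; apply/decayingZ/decaying_shift/decaying_gaussian.
exact: exprn_gt0.
Qed.

Lemma Rintegral_normal_pdf m : \int[mu]_x normal_pdf m s x = 1.
Proof. by rewrite /Rintegral integral_normal_pdf. Qed.

Lemma Rintegral_normal_pdf_id m : \int[mu]_x (normal_pdf m s x * x) = m.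
Proof.
have v0 : 0 < v by exact: exprn_gt0.
have dg := decaying_shift m (decaying_gaussian v0).
have [M1 _ _] := integral_gaussian_moments m v0.
have dN := decaying_normal_pdf m.
have -> : (fun x => normal_pdf m s x * x) =
    (fun x => normal_peak s * ((x - m) * gaussian v (x - m)) + m * normal_pdf m s x).
  by apply/funext => x; rewrite normal_pdfG; ring.
rewrite RintegralD_decaying; [|exact/decayingZ/decaying_mulX|exact: decayingZ].
rewrite !RintegralZ_decaying//; last exact: decaying_mulX.
by rewrite M1 mulr0 add0r Rintegral_normal_pdf mulr1.
Qed.

Lemma is_derive_normal_pdf_mean (V : normedModType R) (x w : V) (m : V -> R) dm p :
  is_derive x w m dm ->
  is_derive x w (fun y => normal_pdf (m y) s p)
    ((p - m x) / v * normal_pdf (m x) s p * dm).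
Proof.
move=> hm.
have -> : (fun y => normal_pdf (m y) s p) =
    (fun y => normal_peak s * expR (- (p - m y) ^+ 2 * (2 * v)^-1)).
  by apply/funext => y; rewrite normal_pdfG.
der; rewrite normal_pdfG /gaussian; field.
by rewrite gt_eqF.
Qed.

Lemma is_derive_normal_pdf m x :
  is_derive x (1 : R) (normal_pdf m s) (- ((x - m) / v) * normal_pdf m s x).
Proof.
have dg := @is_derive_gaussian R v m x (lt0r_neq0 (exprn_gt0 2 s0)).
by rewrite normal_pdfG; der; ring.
Qed.

End normal.

(** * Normalization of the zeros of the collision operator *)

Section equilibrium.
Context {R : realType} (gamma kappa zeta : R) (c : model_case).
Hypothesis zeta0 : 0 < zeta.
Local Notation mu := (@lebesgue_measure R).
Local Notation A := (convolution (idG zeta)).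
Local Notation B := (convolution (G zeta)).
Local Notation C := (convolution (sqG zeta)).
Implicit Types g : R -> R.

(** [G] is positive, so a zero of the convolution would make [g] vanish identically, against its
    positive mass. *)
Lemma convolution_G_gt0 g p : decaying g -> (forall x, 0 <= g x) ->
  0 < \int[mu]_x g x -> 0 < B g p.
Proof.
move=> dg g0 ig; have di := decaying_integrand p (bounded_G zeta0) dg.
have B0 : 0 <= B g p by apply: Rintegral_ge0 => x _; rewrite mulr_ge0// expR_ge0.
rewrite lt_neqAle B0 andbT eq_sym; apply/eqP => Bg0.
have i0 y : 0 <= G zeta (p - y) * g y by rewrite mulr_ge0// expR_ge0.
have gx0 x : g x = 0.
  have /eqP := integral_eq0_decaying di i0 Bg0 x.
  by rewrite mulf_eq0 gt_eqF ?expR_gt0//= => /eqP.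
suff E : \int[mu]_x g x = 0 by rewrite E ltxx in ig.
have -> : g = fun x => 0 * g x by apply/funext => x; rewrite mul0r gx0.
by rewrite RintegralZ_decaying// mul0r.
Qed.

(** [Q] is homogeneous, of degree 2 in the symmetric case and 1 in the non-symmetric case; dividing
    by the mass preserves its zeros. *)
Lemma Q_rate_scale (s a b k g g1 g2 : R) : s != 0 -> H c b != 0 ->
  Q_rate gamma kappa zeta c a b k g g1 g2 = 0 ->
  Q_rate gamma kappa zeta c (s * a) (s * b) (s * k) (s * g) (s * g1) (s * g2) = 0.
Proof.
move=> s0; case: c => /= [_|b0] Q0.
  by rewrite -(mulr0 (s ^+ 2)) -Q0 /sym_rate; ring.
rewrite -(mulr0 s) -Q0 /nonsym_rate; move: (zeta ^+ 2)^-1 => z; field.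
by rewrite s0 b0.
Qed.

Lemma equilibrium_normalize g g1 g2 : decaying g -> (forall x, 0 <= g x) ->
  (forall x, is_derive x (1 : R) g (g1 x)) ->
  (forall x, is_derive x (1 : R) g1 (g2 x)) ->
  0 < \int[mu]_x g x ->
  (forall p, Q c gamma kappa zeta g p = 0) ->
  equilibrium c gamma kappa zeta (fun x => (\int[mu]_x g x)^-1 * g x).
Proof.
move=> dg g0 gg1 g1g2 ig Qg; set r := (\int[mu]_x g x)^-1.
have r0 : 0 < r by rewrite invr_gt0.
have drg := decayingZ r dg.
have d1 x : is_derive x (1 : R) (fun x => r * g x) (r * g1 x).
  by have := gg1 x => ?; der; ring.
have d2 x : is_derive x (1 : R) (fun x => r * g1 x) (r * g2 x).
  by have := g1g2 x => ?; der; ring.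
split.
- split; first by move=> x; rewrite mulr_ge0// ltW.
    by apply: continuous_measurable_fun; case: drg.
  by rewrite EFin_Rintegral// RintegralZ_decaying// /r mulVf// gt_eqF.
- move=> x; split; first by case: (d1 x).
  have -> : derive1 (fun x => r * g x) = fun x => r * g1 x.
    by apply/funext => y; exact: is_derive_derive1.
  by case: (d2 x).
- move=> p; have Bp := convolution_G_gt0 p dg g0 ig.
  have HB : H c (B g p) != 0.
    by case: (c); rewrite /= ?oner_neq0// gt_eqF.
  have bG := bounded_G zeta0; have bI := bounded_idG zeta0; have bS := bounded_sqG zeta0.
  have HrB : H c (B (fun x => r * g x) p) != 0.
    rewrite convolution_scale//; case: (c); rewrite /= ?oner_neq0// gt_eqF//.
    exact: mulr_gt0.
  rewrite (Q_rateE gamma kappa zeta0 drg d1 d2 HrB) !convolution_scale//.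
  have := Qg p; rewrite (Q_rateE gamma kappa zeta0 dg gg1 g1g2 HB).
  by apply: Q_rate_scale => //; rewrite gt_eqF.
Qed.

End equilibrium.

(** * Differentiability of mass and mean opinion *)

Section local_equilibrium.
Context {R : realType} {n : nat} (s : R).
Hypothesis s0 : 0 < s.
Variables (f : phase_fun R n) (rho phi : 'rV[R]_n -> R -> R).
Hypothesis sf : smooth f.
Hypothesis fE : forall a p t, 0 <= t -> f a p t = rho a t * normal_pdf (phi a t) s p.
Local Notation v := (s ^+ 2).
Local Notation pk := (normal_peak s).

Lemma density_gt0 a p t : 0 <= t -> (0 < f a p t) = (0 < rho a t).
Proof. by move=> t0; rewrite fE// pmulr_lgt0// normal_pdf_gt0. Qed.

Lemma normal_peak_sigma_gt0 : 0 < pk.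
Proof. by apply: normal_peak_gt0; rewrite gt_eqF. Qed.

(* The logarithm of a Gaussian is quadratic, so mean and mass can be recovered
   from the values of [f] at the opinions 1, -1 and 0. *)
Lemma phiE a t : 0 <= t -> 0 < rho a t ->
  phi a t = v / 2 * (ln (f a 1 t) - ln (f a (- 1) t)).
Proof.
move=> t0 r0; have p0 := normal_peak_sigma_gt0; rewrite !fE// !normal_pdfG//.
rewrite !lnM ?posrE ?mulr_gt0 ?expR_gt0// /gaussian !expRK.
by field; rewrite gt_eqF.
Qed.

Lemma rhoE a t : 0 <= t ->
  rho a t = f a 0 t * (pk^-1 * expR (phi a t ^+ 2 * (2 * v)^-1)).
Proof.
move=> t0; rewrite fE// normal_pdfG// /gaussian sub0r sqrrN mulNr expRN.
by field; rewrite ?gt_eqF ?expR_gt0 ?normal_peak_sigma_gt0.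
Qed.

Section time.
Variables (a : 'rV[R]_n) (t : R).
Hypotheses (t0 : 0 <= t) (r0 : 0 < rho a t).

Lemma time_derivatives : exists dr dp,
  [/\ is_time_derive (rho a) t dr, is_time_derive (phi a) t dp,
    is_time_derive (fun u => rho a u * phi a u) t (rho a t * dp + phi a t * dr) &
    forall p, time_derive (f a p) t =
      (dr + rho a t * dp * ((p - phi a t) / v)) * normal_pdf (phi a t) s p].
Proof.
have ext p : exists2 h, is_derive t (1 : R) h (pderives [:: Time] f a p t) &
    forall u, 0 <= u -> f a p u = h u.
  exact: (is_time_derive_extension t0 (smooth_is_pderive [::] Time a p sf t0)).
have [h1 dh1 fh1] := ext 1; have [h2 dh2 fh2] := ext (- 1); have [h3 dh3 fh3] := ext 0.
have h1t : 0 < h1 t by rewrite -fh1// density_gt0.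
have h2t : 0 < h2 t by rewrite -fh2// density_gt0.
pose ph u := v / 2 * (ln (h1 u) - ln (h2 u)).
pose rh u := h3 u * (pk^-1 * expR (ph u ^+ 2 * (2 * v)^-1)).
have [dp dph] : exists dp, is_derive t (1 : R) ph dp.
  by eexists; rewrite /ph; repeat der_step.
have [dr drh] : exists dr, is_derive t (1 : R) rh dr.
  by eexists; rewrite /rh; repeat der_step.
(* [ph] and [rh] are the formulas of [phiE] and [rhoE] in the two-sided extensions. They apply at
   nonnegative times near [t], where positivity of [h1] gives that of [rho]. *)
have near_eq : \forall u \near t, 0 <= u -> phi a u = ph u /\ rho a u = rh u.
  have h1n : \forall u \near t, 0 < h1 u.
    by have /cvgr_gt := is_derive_continuous dh1; apply.
  apply: filterS h1n => u h1u u0.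
  have r0u : 0 < rho a u by rewrite -(density_gt0 a 1 u0) fh1.
  have E : phi a u = ph u by rewrite phiE// /ph -fh1// -fh2.
  by split=> //; rewrite rhoE// E /rh -fh3.
have [phit rhot] := nbhs_singleton near_eq t0.
have Dr : is_time_derive (rho a) t dr.
  by apply: (is_time_derive_of t0 drh); apply: filterS near_eq => u H /H[].
have Dp : is_time_derive (phi a) t dp.
  by apply: (is_time_derive_of t0 dph); apply: filterS near_eq => u H /H[].
exists dr, dp; split => //.
  have dm : is_derive t (1 : R) (fun u => rh u * ph u) (rho a t * dp + phi a t * dr).
    by rewrite phit rhot; der.
  apply: (is_time_derive_of t0 dm); apply: filterS near_eq => u H /H[-> ->] //.
move=> p; apply: (time_derive_val t0).
have dN := is_derive_normal_pdf_mean s0 p dph.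
have dm : is_derive t (1 : R) (fun u => rh u * normal_pdf (ph u) s p)
    ((dr + rho a t * dp * ((p - phi a t) / v)) * normal_pdf (phi a t) s p).
  by rewrite phit rhot; der; ring.
apply: (is_time_derive_of t0 dm); apply: filterS near_eq => u H u0.
by rewrite fE//; have [-> ->] := H u0.
Qed.

End time.

Section space.
Variables (t : R) (i : 'I_n).
Hypothesis t0 : 0 <= t.
Local Notation e := (delta_mx 0 i : 'rV[R]_n).

Lemma near_density_gt0 a : 0 < rho a t -> \forall b \near a, 0 < rho b t.
Proof.
rewrite -(density_gt0 a 1 t0) => /(smooth_near_gt0 sf t0).
by apply: filterS => b; rewrite density_gt0.
Qed.

Let fi p b := pderives [:: Position i] f b p t.

Let dfi p b : is_derive b e (fun b => f b p t) (fi p b).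
Proof. exact: (smooth_is_pderive [::] (Position i) b p sf t0). Qed.

(** The derivative of [phi] where [rho > 0], as an explicit expression in [f] and its derivatives
    that can be differentiated once more. *)
Definition phi_i b := v / 2 * (fi 1 b * (f b 1 t)^-1 - fi (- 1) b * (f b (- 1) t)^-1).

Definition rho_i b := fi 0 b * (pk^-1 * expR (phi b t ^+ 2 * (2 * v)^-1))
  + rho b t * (phi b t * phi_i b * v^-1).

Lemma is_derive_phi b : 0 < rho b t -> is_derive b e (phi ^~ t) (phi_i b).
Proof.
move=> r0; have f1 : 0 < f b 1 t by rewrite density_gt0.
have f2 : 0 < f b (- 1) t by rewrite density_gt0.
have d : is_derive b e (fun b => v / 2 * (ln (f b 1 t) - ln (f b (- 1) t))) (phi_i b).
  have d1 := dfi 1 b; have d2 := dfi (- 1) b.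
  by der; rewrite /phi_i; ring.
apply: near_eq_is_derive d.
by apply: filterS (near_density_gt0 r0) => x rx; rewrite phiE.
Qed.

Lemma is_derive_rho b : 0 < rho b t -> is_derive b e (rho ^~ t) (rho_i b).
Proof.
move=> r0; have d0 := dfi 0 b; have dp := is_derive_phi r0.
have d : is_derive b e (fun b => f b 0 t * (pk^-1 * expR (phi b t ^+ 2 * (2 * v)^-1))) (rho_i b).
  der; rewrite /rho_i rhoE//; field.
  by rewrite ?gt_eqF ?normal_peak_sigma_gt0.
apply: near_eq_is_derive d.
by apply: filterS (near_density_gt0 r0) => x rx; rewrite -rhoE.
Qed.

Lemma second_derivatives a : 0 < rho a t -> exists rii pii,
  is_derive a e rho_i rii /\ is_derive a e phi_i pii.
Proof.
move=> r0.
have dfii p : is_derive a e (fi p) (pderives [:: Position i; Position i] f a p t).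
  exact: (smooth_is_pderive [:: Position i] (Position i) a p sf t0).
have f1 : f a 1 t != 0 by rewrite gt_eqF// density_gt0.
have f2 : f a (- 1) t != 0 by rewrite gt_eqF// density_gt0.
have d1 := dfi 1 a; have d2 := dfi (- 1) a.
have d11 := dfii 1; have d22 := dfii (- 1); have d00 := dfii 0.
have dp := is_derive_phi r0; have dr := is_derive_rho r0.
have [pii dpii] : exists pii, is_derive a e phi_i pii.
  by eexists; rewrite /phi_i; repeat der_step.
have [rii drii] : exists rii, is_derive a e rho_i rii.
  by eexists; rewrite /rho_i; repeat der_step.
by exists rii, pii.
Qed.

(** A quadratic polynomial in [p - phi] times the Gaussian. Its linear coefficient times [rho * v]
    is the derivative of [rho ^ 2 * phi_i]: this is how the divergence of the theorem arises. *)
Lemma second_derivative_f a p rii pii : 0 < rho a t ->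
  is_derive a e rho_i rii -> is_derive a e phi_i pii ->
  pderives [:: Position i; Position i] f a p t =
  (rii - rho a t * phi_i a ^+ 2 / v
   + (2 * rho_i a * phi_i a + rho a t * pii) / v * (p - phi a t)
   + rho a t * phi_i a ^+ 2 / v ^+ 2 * (p - phi a t) ^+ 2) * normal_pdf (phi a t) s p.
Proof.
move=> r0 drii dpii.
have fiE b : 0 < rho b t -> pderives [:: Position i] f b p t =
    (rho_i b + rho b t * phi_i b * (v^-1 * (p - phi b t))) * normal_pdf (phi b t) s p.
  move=> rb; have dp := is_derive_phi rb; have dr := is_derive_rho rb.
  have dN := is_derive_normal_pdf_mean s0 p dp.
  have d : is_derive b e (fun b => rho b t * normal_pdf (phi b t) s p)
    ((rho_i b + rho b t * phi_i b * (v^-1 * (p - phi b t))) * normal_pdf (phi b t) s p).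
    by der; ring.
  apply: is_derive_unique (dfi p b) _.
  have -> // : (fun b => f b p t) = (fun b => rho b t * normal_pdf (phi b t) s p).
  by apply/funext => x; rewrite fE.
have dp := is_derive_phi r0; have dr := is_derive_rho r0.
have dN := is_derive_normal_pdf_mean s0 p dp.
have d : is_derive a e (fun b => (rho_i b + rho b t * phi_i b * (v^-1 * (p - phi b t))) *
   normal_pdf (phi b t) s p)
  ((rii - rho a t * phi_i a ^+ 2 / v
   + (2 * rho_i a * phi_i a + rho a t * pii) / v * (p - phi a t)
   + rho a t * phi_i a ^+ 2 / v ^+ 2 * (p - phi a t) ^+ 2) * normal_pdf (phi a t) s p).
  by der; field; rewrite gt_eqF.
apply: (is_derive_unique
  (smooth_is_pderive [:: Position i] (Position i) a p sf t0)).
apply: near_eq_is_derive d.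
by apply: filterS (near_density_gt0 r0) => b rb; rewrite fiE.
Qed.

Lemma is_derive_momentum_flux a pii : 0 < rho a t -> is_derive a e phi_i pii ->
  is_derive a e (fun b => (rho b t ^+ 2 *: grad (phi ^~ t) b) 0 i)
   (rho a t * (2 * rho_i a * phi_i a + rho a t * pii)).
Proof.
move=> r0 dpii; have dr := is_derive_rho r0.
have d : is_derive a e (fun b => rho b t ^+ 2 * phi_i b)
   (rho a t * (2 * rho_i a * phi_i a + rho a t * pii)) by der; ring.
apply: near_eq_is_derive d.
apply: filterS (near_density_gt0 r0) => b rb.
by rewrite !mxE /partial; have [_ ->] := is_derive_phi rb.
Qed.

End space.
End local_equilibrium.

(** * Balance of fluxes *)

Section balance.
Context {R : realType} (gamma kappa zeta D s rho phi dr dp P0 P1 P2 : R).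
Hypotheses (kappa0 : 0 < kappa) (zeta0 : 0 < zeta) (s0 : 0 < s) (rho0 : 0 < rho).
Local Notation mu := (@lebesgue_measure R).
Local Notation A := (convolution (idG zeta)).
Local Notation B := (convolution (G zeta)).
Local Notation C := (convolution (sqG zeta)).
Local Notation z := ((zeta ^+ 2)^-1).
Local Notation v := (s ^+ 2).
Local Notation N := (normal_pdf phi s).
Local Notation pk := (normal_peak s).
(** At a fixed position and time, [g] stands for [f], [w] for [f1] and [h] for the Laplacian of [f];
    [dr] and [dp] stand for the time derivatives of [rho] and [phi]. *)
Variables (g g1 g2 w w1 w2 h : R -> R).
Hypotheses (dg : decaying g) (dg1 : decaying g1) (dw : decaying w) (dw1 : decaying w1)
  (dh : decaying h).
Hypotheses (gg1 : forall x, is_derive x (1 : R) g (g1 x))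
  (g1g2 : forall x, is_derive x (1 : R) g1 (g2 x))
  (ww1 : forall x, is_derive x (1 : R) w (w1 x))
  (w1w2 : forall x, is_derive x (1 : R) w1 (w2 x)).
Hypothesis gE : forall x, g x = rho * N x.
Hypothesis hE : forall x, h x = (P0 + P1 * (x - phi) + P2 * (x - phi) ^+ 2) * N x.

Let v0 : 0 < v. Proof. exact: exprn_gt0. Qed.
Let z0 : 0 < zeta ^+ 2. Proof. exact: exprn_gt0. Qed.
Let vz0 : 0 < v + zeta ^+ 2. Proof. exact: addr_gt0. Qed.
Let vvz0 : 0 < 2 * v + zeta ^+ 2. Proof. by rewrite addr_gt0// mulr_gt0. Qed.
(** [beta] is the factor in the convolution of [G] with a Gaussian of variance [v], [drift] is the
    slope of [A g / B g], and [u] is the variance of the product of [g] and [B g]. *)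
Let beta := Num.sqrt (2 * pi * (v * zeta ^+ 2 / (v + zeta ^+ 2))).
Let drift := zeta ^+ 2 / (v + zeta ^+ 2).
Let u := v * (v + zeta ^+ 2) / (v + (v + zeta ^+ 2)).

Let u0 : 0 < u. Proof. by rewrite divr_gt0 ?mulr_gt0// addr_gt0. Qed.

Let beta0 : 0 < beta.
Proof. by rewrite sqrtr_gt0 !mulr_gt0 ?pi_gt0// invr_gt0. Qed.

Lemma density_score x : g1 x = - ((x - phi) / v) * g x.
Proof.
apply: is_derive_unique (gg1 x) _; have dN := is_derive_normal_pdf s0 phi x.
have -> : g = fun x => rho * N x by apply/funext.
by der; ring.
Qed.

Lemma density_gaussian : g = fun x => rho * pk * gaussian v (x - phi).
Proof. by apply/funext => x; rewrite gE normal_pdfG// mulrA. Qed.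

Lemma convolution_G_density x : B g x = rho * pk * beta * gaussian (v + zeta ^+ 2) (x - phi).
Proof.
have dgs := decaying_shift phi (decaying_gaussian v0); have bG := bounded_G zeta0.
rewrite density_gaussian convolution_scale// convolution_G_gaussian//.
exact: mulrA.
Qed.

Lemma convolution_idG_density x : A g x = drift * (x - phi) * B g x.
Proof.
have dgs := decaying_shift phi (decaying_gaussian v0).
have bG := bounded_G zeta0; have bI := bounded_idG zeta0.
by rewrite density_gaussian !convolution_scale// convolution_idG_gaussian// /drift; ring.
Qed.

Lemma convolution_G_density_gt0 x : 0 < B g x.
Proof. by rewrite convolution_G_density !mulr_gt0 ?gaussian_gt0 ?normal_peak_sigma_gt0. Qed.

(** [B g] has the larger variance, so the quotient is again a Gaussian, with
    [1 / u' = 1 / v - 1 / (v + zeta ^ 2)]. This tames the divisions by [B g] in the non-symmetric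
    fluxes. *)
Lemma decaying_density_ratio : decaying (fun x => g x / B g x).
Proof.
have [u' u'0 u'E] : exists2 u', 0 < u' & u' * (v + zeta ^+ 2) / (u' + (v + zeta ^+ 2)) = v.
  exists (v * (v + zeta ^+ 2) / zeta ^+ 2); first by rewrite divr_gt0 ?mulr_gt0.
  field.
  by rewrite (gt_eqF zeta0) gt_eqF// addr_gt0 ?mulr_gt0.
have -> : (fun x => g x / B g x) = (fun x => beta^-1 * gaussian u' (x - phi)).
  apply/funext => x; rewrite convolution_G_density {1}density_gaussian.
  have := gaussianM (x - phi) u'0 vz0; rewrite u'E => <-.
  field.
  by rewrite !gt_eqF ?gaussian_gt0 ?normal_peak_sigma_gt0.
exact/decayingZ/decaying_shift/decaying_gaussian.
Qed.

Lemma integral_moment (k : nat) m :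
  \int[mu]_x ((x - phi) ^+ k * gaussian u (x - phi)) = m ->
  \int[mu]_x ((x - phi) ^+ k * (N x * B g x)) = rho * pk ^+ 2 * beta * m.
Proof.
move=> <-.
have -> : (fun x => (x - phi) ^+ k * (N x * B g x)) = (fun x =>
    rho * pk ^+ 2 * beta * ((x - phi) ^+ k * gaussian u (x - phi))).
  apply/funext => x; rewrite convolution_G_density normal_pdfG// /u -gaussianM//.
  by ring.
rewrite RintegralZ_decaying//.
exact: (decaying_shift phi (decaying_mul_monomial k (decaying_gaussian u0))).
Qed.

(** The integral of [N] against its convolution with [G]. *)
Definition overlap := pk ^+ 2 * beta * Num.sqrt (2 * pi * u).

Lemma integral_overlap : \int[mu]_x (N x * B g x) = rho * overlap.
Proof.
have := @integral_moment 0 (Num.sqrt (2 * pi * u)).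
have E : (fun x => (x - phi) ^+ 0 * gaussian u (x - phi)) = (fun x => gaussian u (x - phi)).
  by apply/funext => x; rewrite mul1r.
have E' : (fun x => (x - phi) ^+ 0 * (N x * B g x)) = (fun x => N x * B g x).
  by apply/funext => x; rewrite mul1r.
rewrite E E' => -> //; last exact: integral_gaussian.
by rewrite /overlap; ring.
Qed.

Lemma overlapE : overlap = zeta / Num.sqrt (2 * v + zeta ^+ 2).
Proof.
have pi0 : 0 < pi :> R by exact: pi_gt0.
have pk2 : pk ^+ 2 = (2 * pi * v)^-1.
  have p0 : 0 <= v * pi *+ 2 by rewrite mulrn_wge0// mulr_ge0// ltW.
  by rewrite /normal_peak exprVn sqr_sqrtr// -mulr_natr; congr (_^-1); ring.
rewrite /overlap pk2 /beta -mulrA -sqrtrM; last first.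
  by rewrite !mulr_ge0 ?invr_ge0 ?sqr_ge0 ?ltW.
have -> : 2 * pi * (v * zeta ^+ 2 / (v + zeta ^+ 2)) * (2 * pi * u) =
    (2 * pi * v * zeta) ^+ 2 * (2 * v + zeta ^+ 2)^-1.
  rewrite /u; field.
  by rewrite !gt_eqF//= addr_gt0.
rewrite sqrtrM ?sqr_ge0// sqrtr_sqr gtr0_norm ?mulr_gt0// sqrtrV; last exact: ltW.
have sq0 : 0 < Num.sqrt (2 * v + zeta ^+ 2) by rewrite sqrtr_gt0.
move: (@pi R) pi0 => p p0; field.
by rewrite !gt_eqF.
Qed.

(** [A g] is odd about [phi] and the odd moments vanish, so of the three coefficients of [h] only
    [P1] survives. *)
Lemma integral_drift_lap :
  \int[mu]_x (A g x * h x) = zeta ^+ 2 / (2 * v + zeta ^+ 2) * overlap * (rho * v * P1).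
Proof.
have [M1 M2 M3] := integral_gaussian_moments phi u0.
have I1 := @integral_moment 1 0 _; have I2 := integral_moment M2; have I3 := integral_moment M3.
have {}I1 := I1 M1.
pose q x := N x * B g x.
have dN := decaying_normal_pdf s0 phi.
have dq : decaying q.
  have -> : q = fun x => B g x * N x by apply/funext => x; rewrite /q mulrC.
  by apply: decayingM dN; exact: bounded_convolution_G.
have dqk k : decaying (fun x => (x - phi) ^+ k * q x).
  elim: k => [|k IH].
    by move: dq; congr decaying; apply/funext => x; rewrite mul1r.
  have := decaying_mulX phi IH; congr decaying; apply/funext => x.
  by rewrite exprS mulrA.
have -> : (fun x => A g x * h x) = (fun x =>
    drift * P0 * ((x - phi) ^+ 1 * q x) + drift * P1 * ((x - phi) ^+ 2 * q x)
    + drift * P2 * ((x - phi) ^+ 3 * q x)).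
  by apply/funext => x; rewrite convolution_idG_density hE /q; ring.
have dz k r := decayingZ r (dqk k).
rewrite !RintegralD_decaying//; last exact: decayingD.
rewrite !RintegralZ_decaying//.
have {}I1 : \int[mu]_x ((x - phi) ^+ 1 * q x) = _ := I1.
have {}I2 : \int[mu]_x ((x - phi) ^+ 2 * q x) = _ := I2.
have {}I3 : \int[mu]_x ((x - phi) ^+ 3 * q x) = _ := I3.
rewrite I1 I2 I3.
rewrite integral_gaussian// /overlap /drift /u; field.
by rewrite !gt_eqF//= ?addr_gt0.
Qed.

(** The flux of [Q] linearized at [g] in the direction [w]: the first summand varies the
    convolutions, the second the remaining factor. *)
Definition collision_flux (c : model_case) x :=
  match c with
  | Symmetric => sym_flux kappa zeta w g g1 x + sym_flux kappa zeta g w w1 x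
  | NonSymmetric => nonsym_flux zeta w g x + (A g x / B g x * w x + kappa / 2 * w1 x)
  end.

Definition interaction_flux (c : model_case) x :=
  match c with
  | Symmetric => sym_flux kappa zeta h g g1 x
  | NonSymmetric => nonsym_flux zeta h g x
  end.

Lemma decaying_sym_flux a b b1 : decaying a -> decaying b -> decaying b1 ->
  decaying (sym_flux kappa zeta a b b1).
Proof.
move=> da db db1; apply: decayingD; apply/decayingZ/decayingM => //.
- exact: bounded_convolution_idG.
- exact: bounded_convolution_G.
Qed.

Lemma decaying_nonsym_flux a : decaying a -> decaying (nonsym_flux zeta a g).
Proof.
move=> da; have dq := decaying_density_ratio.
have -> : nonsym_flux zeta a g = fun x => A a x * (g x / B g x)
    - B a x * (drift * ((x - phi) * (g x / B g x))).
  apply/funext => x; rewrite /nonsym_flux convolution_idG_density; field.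
  by rewrite gt_eqF// convolution_G_density_gt0.
apply: decayingB; apply: decayingM => //.
- exact: bounded_convolution_idG.
- exact: bounded_convolution_G.
- exact/decayingZ/decaying_mulX.
Qed.

Lemma driftE (f : R -> R) x : A g x / B g x * f x = drift * ((x - phi) * f x).
Proof.
rewrite convolution_idG_density; field.
by rewrite gt_eqF// convolution_G_density_gt0.
Qed.

Lemma decaying_collision_flux c : decaying (collision_flux c).
Proof.
case: c; first by apply: decayingD; exact: decaying_sym_flux.
apply: decayingD; first exact: decaying_nonsym_flux.
apply: decayingD; last exact: decayingZ.
have -> : (fun x => A g x / B g x * w x) = (fun x => drift * ((x - phi) * w x)).
  by apply/funext => x; exact: driftE.
exact/decayingZ/decaying_mulX.
Qed.

Lemma decaying_interaction_flux c : decaying (interaction_flux c).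
Proof. by case: c; [exact: decaying_sym_flux|exact: decaying_nonsym_flux]. Qed.

Lemma is_derive_collision_flux c x : is_derive x (1 : R) (collision_flux c)
  (linear_rate kappa zeta c (A g x) (B g x) (C g x) (A w x) (B w x) (C w x)
      (g x) (g1 x) (g2 x) (w x) (w1 x) (w2 x)).
Proof.
have B0 : B g x != 0 by rewrite gt_eqF// convolution_G_density_gt0.
case: c => /=; apply: is_derive_add.
- exact: is_derive_sym_flux.
- exact: is_derive_sym_flux.
- exact: is_derive_nonsym_flux.
have dA := is_derive_convolution_idG zeta0 x dg.
have dB := is_derive_convolution_G zeta0 x dg.
have := ww1 x; have := w1w2 x => ? ?.
der; rewrite /nonsym_rate; move: (zeta ^+ 2)^-1 => z'; field.
by rewrite B0.
Qed.

(* Integrating the limit equation once in the opinion variable. *)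
Lemma flux_balance c :
  (forall x, (dr + rho * dp * ((x - phi) / v)) * N x
     + R_rate gamma kappa zeta D c (A g x) (B g x) (C g x) (A h x) (B h x) (C h x)
         (g x) (g1 x) (g2 x) =
     gamma * linear_rate kappa zeta c (A g x) (B g x) (C g x) (A w x) (B w x) (C w x)
         (g x) (g1 x) (g2 x) (w x) (w1 x) (w2 x)) ->
  dr = 0 /\ forall x, rho * dp * N x =
    - gamma * collision_flux c x - gamma * D * interaction_flux c x.
Proof.
move=> E; have dN := decaying_normal_pdf s0 phi.
(* The derivative of [rho * dp * N] is minus the part of [d_t f] due to the motion of the mean.
   Hence [W' = dr * N], of constant sign. *)
pose W x := gamma * collision_flux c x + gamma * D * interaction_flux c x + rho * dp * N x.
have dW : decaying W.
  apply: decayingD; last exact: decayingZ.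
  apply: decayingD; apply: decayingZ; first exact: decaying_collision_flux.
  exact: decaying_interaction_flux.
have [||x|x|dr0 W0] := @eq0_of_derive_sign R W N dr.
- exact: decaying_cvgy.
- exact: decaying_cvgNy.
- have d1 := is_derive_collision_flux c x.
  have dNx := is_derive_normal_pdf s0 phi x.
  have B0 : B g x != 0 by rewrite gt_eqF// convolution_G_density_gt0.
  have [r d2 rE] : exists2 r, is_derive x (1 : R) (interaction_flux c) r &
      R_rate gamma kappa zeta D c (A g x) (B g x) (C g x) (A h x) (B h x) (C h x)
         (g x) (g1 x) (g2 x) = - gamma * D * r.
    case: (c) => /=.
      by eexists; first exact: is_derive_sym_flux.
    by eexists; first exact: is_derive_nonsym_flux.
  have := E x; rewrite rE => Ex.
  rewrite /W; der; rewrite !mulr0 !addr0 -Ex.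
  by ring.
- exact: normal_pdf_gt0.
split=> // x; have := W0 x; rewrite /W => /eqP.
rewrite addrC addr_eq0 => /eqP ->.
by ring.
Qed.

(** Integration by parts, with [(B a)' = - z * A a]. *)
Lemma integral_derive_product a b b1 : decaying a -> decaying b -> decaying b1 ->
  (forall x, is_derive x (1 : R) b (b1 x)) ->
  \int[mu]_x (B a x * b1 x) = z * \int[mu]_x (A a x * b x).
Proof.
move=> da db db1 bb1.
have bA := bounded_convolution_idG zeta0 da; have bB := bounded_convolution_G zeta0 da.
have d1 := decayingM bA db; have d2 := decayingM bB db1.
have : \int[mu]_x (B a x * b1 x - z * (A a x * b x)) = 0.
  apply: (@integral_derive0 _ (fun x => B a x * b x)
    (fun x => B a x * b1 x - z * (A a x * b x))).
  - exact: decayingM.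
  - by apply: decayingB => //; exact: decayingZ.
  - move=> x; have dB := is_derive_convolution_G zeta0 x da; have := bb1 x => ?.
    by der; ring.
rewrite RintegralB_decaying//; last exact: decayingZ.
by rewrite RintegralZ_decaying// => /eqP; rewrite subr_eq0 => /eqP.
Qed.

(** The terms in [kappa] form the total derivative of [kappa / 2 * B a * b]. *)
Lemma integral_sym_flux a b b1 : decaying a -> decaying b -> decaying b1 ->
  (forall x, is_derive x (1 : R) b (b1 x)) ->
  \int[mu]_x sym_flux kappa zeta a b b1 x = \int[mu]_x (A a x * b x).
Proof.
move=> da db db1 bb1.
have bA := bounded_convolution_idG zeta0 da; have bB := bounded_convolution_G zeta0 da.
have d1 := decayingM bA db; have d2 := decayingM bB db1.
rewrite /sym_flux RintegralD_decaying; [|exact: decayingZ|exact: decayingZ].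
rewrite !RintegralZ_decaying// (integral_derive_product da db db1 bb1).
by ring.
Qed.

(** The collision flux integrates to the sum of [A w * g] and [A g * w], which is zero by
    antisymmetry. *)
Lemma symmetric_balance :
  (forall x, rho * dp * N x = - gamma * collision_flux Symmetric x
     - gamma * D * interaction_flux Symmetric x) ->
  rho * dp = gamma * D * \int[mu]_x (A g x * h x).
Proof.
move=> E; rewrite -[LHS]mulr1 -(Rintegral_normal_pdf s phi).
rewrite -RintegralZ_decaying; last exact: decaying_normal_pdf.
under eq_Rintegral do rewrite E.
have d1 := decaying_collision_flux Symmetric; have d2 := decaying_interaction_flux Symmetric.
rewrite RintegralB_decaying; [|exact: decayingZ|exact: decayingZ].
rewrite !RintegralZ_decaying//= RintegralD_decaying; [|exact: decaying_sym_flux..].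
rewrite !integral_sym_flux// (integral_convolution_idG zeta0 dw dg).
rewrite (integral_convolution_idG zeta0 dh dg).
by ring.
Qed.

(* The weight [B g] is the derivative of the (density dependent) collision invariant
   that replaces the opinion itself in the non-symmetric case. *)
Lemma integral_weighted_flux a : v * drift = kappa / 2 -> decaying a ->
  \int[mu]_x (B g x * nonsym_flux zeta a g x) =
  (1 + kappa / 2 * z) * \int[mu]_x (A a x * g x).
Proof.
move=> kE da.
have bA := bounded_convolution_idG zeta0 da; have bB := bounded_convolution_G zeta0 da.
have d1 := decayingM bA dg; have d2 := decayingM bB dg1.
(* By [density_score] and [kE], [A g / B g * g = - kappa / 2 * g1]; the weight clears the other
   denominator. *)
have -> : (fun x => B g x * nonsym_flux zeta a g x) =
    (fun x => A a x * g x + kappa / 2 * (B a x * g1 x)).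
  apply/funext => x; rewrite /nonsym_flux convolution_idG_density density_score -kE; field.
  by rewrite !gt_eqF// convolution_G_density_gt0.
rewrite RintegralD_decaying//; last exact: decayingZ.
rewrite RintegralZ_decaying// (integral_derive_product da dg dg1 gg1).
by ring.
Qed.

(** Both halves of the weighted collision flux acquire the same factor [1 + kappa / 2 * z], so
    antisymmetry again cancels the terms in [w]. *)
Lemma nonsymmetric_balance : v * drift = kappa / 2 ->
  (forall x, rho * dp * N x = - gamma * collision_flux NonSymmetric x
     - gamma * D * interaction_flux NonSymmetric x) ->
  rho * dp * (rho * overlap) = gamma * D * (1 + kappa / 2 * z) * \int[mu]_x (A g x * h x).
Proof.
move=> kE E; rewrite -integral_overlap.
have bB := bounded_convolution_G zeta0 dg; have bA := bounded_convolution_idG zeta0 dg.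
have dN := decaying_normal_pdf s0 phi.
have -> : (fun x => N x * B g x) = (fun x => B g x * N x) by apply/funext => x; rewrite mulrC.
have <- := RintegralZ_decaying (rho * dp) (decayingM bB dN).
have d1 := decayingM bB (decaying_nonsym_flux dw).
have d2 := decayingM bB (decaying_nonsym_flux dh).
have d3 := decayingM bA dw; have d4 := decayingM bB dw1.
have E2 x : rho * dp * (B g x * N x) =
    - gamma * (B g x * nonsym_flux zeta w g x + (A g x * w x + kappa / 2 * (B g x * w1 x)))
    - gamma * D * (B g x * nonsym_flux zeta h g x).
  rewrite mulrCA E /=; field.
  by rewrite gt_eqF// convolution_G_density_gt0.
under eq_Rintegral do rewrite E2.
have d5 : decaying (fun x => A g x * w x + kappa / 2 * (B g x * w1 x)).
  by apply: decayingD => //; exact: decayingZ.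
rewrite RintegralB_decaying; [|exact/decayingZ/decayingD|exact: decayingZ].
rewrite !RintegralZ_decaying//; last exact: decayingD.
rewrite !RintegralD_decaying//; last exact: decayingZ.
rewrite RintegralZ_decaying// (integral_derive_product dg dw dw1 ww1).
rewrite !integral_weighted_flux// (integral_convolution_idG zeta0 dw dg).
rewrite (integral_convolution_idG zeta0 dh dg).
by ring.
Qed.

Lemma momentum_balance c : (c = NonSymmetric -> v * drift = kappa / 2) ->
  (forall x, rho * dp * N x = - gamma * collision_flux c x
     - gamma * D * interaction_flux c x) ->
  rho * dp * (if c is NonSymmetric then rho * overlap else 1) =
  gamma * D * (if c is NonSymmetric then 1 + kappa / 2 * z else 1)
    * \int[mu]_x (A g x * h x).
Proof.
case: c => [_|/(_ erefl)]; last exact: nonsymmetric_balance.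
by move=> /symmetric_balance ->; rewrite !mulr1.
Qed.

End balance.

(** * Conservation of mass *)

Section constant_in_time.
Context {R : realType}.
Implicit Types m : R -> R.

(** Continued by the constant [m 0] to negative times, [m] has zero derivative on the whole line. *)
Lemma constant_of_time_derive0 m : (forall t, 0 <= t -> is_time_derive m t 0) ->
  forall t u, 0 <= t -> 0 <= u -> m t = m u.
Proof.
move=> dm; pose k (x : R) := m (Num.max x 0).
have dk x : is_derive x (1 : R) k 0.
  have [x0|x0] := ltP x 0.
    have : is_derive x (1 : R) (cst (m 0)) 0 by exact: is_derive_cst.
    apply: near_eq_is_derive.
    have : \forall y \near x, y < 0 by exact: lt_nbhsl.
    by apply: filterS => y y0; rewrite /k /= max_r// ltW.
  apply/is_derive_quotientP/cvgrPdist_le => e e0.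
  have /cvgrPdist_le/(_ e e0) dme := dm x x0.
  have {}dme : \forall y \near x^', 0 <= y -> `|0 - time_quotient m x y| <= e by [].
  have [/eqP x00|xn0] := boolP (x == 0).
    near=> y; have [y0|y0] := leP 0 y.
      have := near dme y; rewrite /time_quotient /k (max_l y0) (max_l x0).
      by apply => //; near: y.
    rewrite /time_quotient /k (max_l x0) x00 (max_r (ltW y0)) subrr mul0r subrr normr0.
    exact: ltW.
  have xp : 0 < x by rewrite lt_neqAle x0 eq_sym xn0.
  near=> y.
  have y0 : 0 <= y by apply: ltW; near: y; apply: nbhs_dnbhs; exact: lt_nbhsr.
  have := near dme y; rewrite /time_quotient /k (max_l y0) (max_l x0).
  by apply => //; near: y.
move=> t u t0 u0; have := is_derive_0_is_cst t u dk.
by rewrite /k !max_l.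
Unshelve. all: by end_near. Qed.

(* Truncating [m] from below at [c / 2] removes the points where it vanishes. *)
Lemma constant_of_time_derive0_pos m :
  (forall t, 0 <= t -> 0 <= m t) ->
  (forall t, 0 <= t -> 0 < m t -> is_time_derive m t 0) ->
  (forall t, 0 <= t -> m t = 0 -> forall e, 0 < e -> \forall u \near t, 0 <= u -> m u < e) ->
  forall t, 0 <= t -> is_time_derive m t 0.
Proof.
move=> m0 dm cm t t0.
have [mt0|mt0] := eqVneq (m t) 0; last first.
  by apply: dm => //; rewrite lt_neqAle eq_sym mt0 m0.
suff z u : 0 <= u -> m u = 0.
  by apply: (is_time_derive_eq t0 (is_derive_cst _ _ _)) => u u0; exact: z.
move=> u0; apply/eqP; apply: contraT => mu0.
have mup : 0 < m u by rewrite lt_neqAle eq_sym mu0 m0.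
pose c := m u / 2; have c0 : 0 < c by rewrite divr_gt0.
pose k x := Num.max (m x) c.
have near_lt x : 0 <= x -> m x < c -> \forall y \near x, 0 <= y -> m y < c.
  move=> x0 mxc; have [mx0|mxn0] := eqVneq (m x) 0; first exact: cm.
  have mx : 0 < m x by rewrite lt_neqAle eq_sym mxn0 m0.
  have [h dh mh] := is_time_derive_extension x0 (dm x x0 mx).
  have /cvgr_lt/(_ c) := is_derive_continuous dh; rewrite -mh// => /(_ mxc).
  by apply: filterS => y hy y0; rewrite mh.
have dk x : 0 <= x -> is_time_derive k x 0.
  move=> x0; have [mxc|cmx] := ltP (m x) c.
    apply: (is_time_derive_of x0 (is_derive_cst c x 1)).
    apply: filterS (near_lt x x0 mxc) => y H y0.
    by rewrite /k max_r// ltW// H.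
  have mx : 0 < m x by exact: lt_le_trans cmx.
  have /cvgrPdist_le dmx := dm x x0 mx.
  apply/cvgrPdist_le => e e0; have {}dmx := dmx e e0.
  have {}dmx : \forall y \near x^', 0 <= y -> `|0 - time_quotient m x y| <= e by [].
  suff : \forall y \near x^', 0 <= y -> `|0 - time_quotient k x y| <= e by [].
  (* Truncation does not increase distances, so the quotient of [k] is bounded by that of [m]. This
     also covers the points where [m x = c]. *)
  apply: filterS dmx => y H y0; apply: le_trans (H y0).
  rewrite !sub0r !normrN /time_quotient !normrM ler_wpM2r// /k (max_l cmx).
  have [myc|cmy] := leP (m y) c; last by [].
  rewrite !ler0_norm ?subr_le0//; last exact: le_trans cmx.
  by rewrite lerN2 lerD2r.
(* The constant [k] takes the value [c] at [t], where [m] vanishes, and [m u = 2 * c] at [u]. *)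
have := constant_of_time_derive0 dk t0 u0.
rewrite /k mt0 max_r ?ltW// max_l; last by rewrite /c ler_pdivrMr// ler_pMr// ler1n.
move=> E; have E' : m u / 2 = m u by exact: E.
by move: E' mup; clear; lra.
Qed.

End constant_in_time.

(** * The mass near a time at which it vanishes *)

Section vanishing.
Context {R : realType} {n : nat} (s : R).
Hypothesis s0 : 0 < s.
Variables (f : phase_fun R n) (rho phi : 'rV[R]_n -> R -> R).
Hypothesis rf : regular f.
Hypothesis fE : forall a p t, 0 <= t -> f a p t = rho a t * normal_pdf (phi a t) s p.
Hypothesis rho_ge0 : forall a t, 0 <= t -> 0 <= rho a t.
Local Notation pk := (normal_peak s).

(* Mass cannot vanish suddenly: a profile of mass at least [e] has its peak in a
   bounded region because [f] decays, hence [f a 0 t] is bounded below. *)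
Lemma density_small_near a t e : 0 <= t -> rho a t = 0 -> 0 < e ->
  \forall u \near t, 0 <= u -> rho a u < e.
Proof.
move=> t0 rt0 e0; have [sf df] := rf.
have [C fC] := df (Num.max `|a| (t + 1)) [::] 2%N.
have p0 := normal_peak_sigma_gt0 s0.
(* A lower bound for [f a 0 u] when [rho a u >= e]: decay at the peak gives
   [phi ^ 2 * rho * pk <= C], hence [phi ^ 2 <= C / (e * pk)]. *)
pose b := e * pk * expR (- ((C / (e * pk)) / (s ^+ 2 *+ 2))).
have b0 : 0 < b by rewrite !mulr_gt0 ?expR_gt0.
have := is_time_derive_continuous t0 (smooth_is_pderive [::] Time a 0 sf t0).
have b20 : 0 < b / 2 by rewrite divr_gt0.
move=> /(_ _ b20) near1.
have near2 : \forall u \near t, u < t + 1 by apply: lt_nbhsl; rewrite ltrDl.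
apply: filterS2 near1 near2 => u H1 u1 u0; rewrite ltNge; apply/negP => eu.
have := H1 u0; rewrite /= [f a 0 t]fE// rt0 mul0r sub0r normrN.
have f0 : 0 <= f a 0 u by rewrite fE// mulr_ge0 ?rho_ge0// normal_pdf_ge0.
rewrite ger0_norm// leNgt => /negP; apply.
apply: (@lt_le_trans _ _ b); first by rewrite ltr_pdivrMr// ltr_pMr// ltr1n.
rewrite fE// normal_pdfG// /b /gaussian -mulrA.
apply: ler_pM => //; [exact: ltW|by rewrite mulr_ge0 ?expR_ge0// ltW|].
rewrite ler_pM2l// ler_expR sub0r sqrrN mulNr lerN2 mulr_natl ler_wpM2r//.
  by rewrite invr_ge0 mulrn_wge0// sqr_ge0.
rewrite ler_pdivlMr ?mulr_gt0//.
have ar : `|a| <= Num.max `|a| (t + 1) by rewrite le_max lexx.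
have ur : 0 <= u <= Num.max `|a| (t + 1) by rewrite u0 le_max (ltW u1) orbT.
apply: le_trans (fC a (phi a u) u ar ur).
rewrite -normrX ger0_norm ?sqr_ge0// ler_wpM2l ?sqr_ge0//.
rewrite /= fE// normal_pdfG// subrr /gaussian expr0n /= oppr0 mul0r expR0 mulr1.
by rewrite ger0_norm ?mulr_ge0 ?rho_ge0 ?(ltW p0)// ler_wpM2r// ltW.
Qed.

End vanishing.

(** * The hydrodynamic limit *)

Lemma powR32 (R : realType) (x : R) : 0 < x -> x `^ (3 / 2) = x * Num.sqrt x.
Proof.
move=> x0; have -> : 3 / 2 = 1 + 2^-1 :> R by field.
rewrite powRD; last by rewrite gt_eqF ?implybT.
by rewrite powRr1 ?powR12_sqrt// ltW.
Qed.

(** In the symmetric case [overlap] supplies the third factor of [zeta] and the root. In the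
    non-symmetric case it cancels, and [1 + kappa / (2 zeta ^ 2) = (2 v + zeta ^ 2) / (v + zeta ^
    2)] with [v = s ^ 2] replaces the denominator. *)
Lemma transport_coefficient (R : realType) (c : model_case)
    (gamma kappa zeta D s rho dp J : R) :
  0 < kappa -> 0 < zeta -> kappa_condition c kappa zeta -> s = sigma c kappa zeta ->
  0 < rho ->
  rho * dp * (if c is NonSymmetric then rho * overlap zeta s else 1) =
  gamma * D * (if c is NonSymmetric then 1 + kappa / 2 * (zeta ^+ 2)^-1 else 1)
    * (zeta ^+ 2 / (2 * s ^+ 2 + zeta ^+ 2) * overlap zeta s * J) ->
  rho * dp = match c with
             | Symmetric => C_s gamma kappa zeta D * J
             | NonSymmetric => C_a gamma kappa zeta D / rho * J
             end.
Proof.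
move=> k0 z0 kz sE r0; have [sg0 sg2] := sigma_sqr k0 z0 kz.
rewrite -sE in sg0 sg2.
have z20 : 0 < zeta ^+ 2 by exact: exprn_gt0.
have v0 : 0 < s ^+ 2 by exact: exprn_gt0.
have X0 : 0 < 2 * s ^+ 2 + zeta ^+ 2 by rewrite addr_gt0// mulr_gt0.
have q0 : 0 < Num.sqrt (2 * s ^+ 2 + zeta ^+ 2) by rewrite sqrtr_gt0.
rewrite overlapE//; move: q0; set q := Num.sqrt _ => q0.
move: kz sE sg2; case: c => /= kz sE sg2 E.
  rewrite /C_s -sE powR32// -/q; move: E; rewrite !mulr1 => ->.
  by field; rewrite !gt_eqF.
have d0 : 0 < 2 * zeta ^+ 2 - kappa by rewrite subr_gt0.
rewrite /C_a -sE.
have y0 : 0 < zeta / q by rewrite divr_gt0.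
have ry : rho * (zeta / q) != 0 by rewrite mulf_neq0 ?gt_eqF.
apply: (mulIf ry); rewrite E.
have -> : kappa = 2 * s ^+ 2 * zeta ^+ 2 / (s ^+ 2 + zeta ^+ 2).
  rewrite sg2; field.
  by rewrite (gt_eqF d0) gt_eqF// addr_gt0 ?mulr_gt0.
field.
by rewrite !gt_eqF// addr_gt0.
Qed.

(** The balance of drift and diffusion, which is the equation defining [sigma] in this case. *)
Lemma nonsymmetric_drift (R : realType) (kappa zeta : R) :
  0 < kappa -> 0 < zeta -> kappa_condition NonSymmetric kappa zeta ->
  sigma NonSymmetric kappa zeta ^+ 2 *
    (zeta ^+ 2 / (sigma NonSymmetric kappa zeta ^+ 2 + zeta ^+ 2)) = kappa / 2.
Proof.
move=> k0 z0 kz; have [_ ->] := sigma_sqr k0 z0 kz; have z20 := zeta_sqr_gt0 z0.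
have d0 : 0 < 2 * zeta ^+ 2 - kappa by rewrite subr_gt0.
field.
by rewrite (gt_eqF d0) gt_eqF// addr_gt0 ?mulr_gt0.
Qed.

Section hydrodynamic_limit.
Context {R : realType} {n : nat} (gamma kappa zeta D : R) (c : model_case).
Hypotheses (kappa0 : 0 < kappa) (zeta0 : 0 < zeta).
Hypothesis hc : kappa_condition c kappa zeta.
Local Notation s := (sigma c kappa zeta).
Local Notation mu := (@lebesgue_measure R).
Local Notation A := (convolution (idG zeta)).
Local Notation B := (convolution (G zeta)).
Local Notation C := (convolution (sqG zeta)).
Hypothesis heq : forall g : R -> R, equilibrium c gamma kappa zeta g ->
  exists m : R, g = normal_pdf m s.
Variables (feps : R -> phase_fun R n) (f f1 : phase_fun R n).
Hypothesis hsol : \forall e \near 0^'+, solution c gamma kappa zeta D e (feps e).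
Hypotheses (rf : regular f) (rf1 : regular f1).
Hypothesis hlim : littleo_eps2 (fun e a p t => feps e a p t - f a p t - e ^+ 2 * f1 a p t).
Variables rho phi : 'rV[R]_n -> R -> R.
Hypothesis hrho : forall a t, 0 <= t -> \int[mu]_p f a p t = rho a t.
Hypothesis hphi : forall a t, 0 <= t -> \int[mu]_p (f a p t * p) = rho a t * phi a t.

Let s0 : 0 < s. Proof. by have [] := sigma_sqr kappa0 zeta0 hc. Qed.

Lemma rho_ge0 a t : 0 <= t -> 0 <= rho a t.
Proof.
move=> t0; rewrite -hrho//; apply: Rintegral_ge0 => p _.
exact: (limit_ge0 hsol rf rf1 hlim).
Qed.

Lemma limit_convolution_neq0 a p t : 0 <= t -> 0 < rho a t ->
  H c (B (fun q => f a q t) p) != 0.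
Proof.
move=> t0 r0; have Bp : 0 < B (fun q => f a q t) p.
  apply: (convolution_G_gt0 zeta0 p (regular_decaying [::] a rf t0)).
    by move=> q; exact: (limit_ge0 hsol rf rf1 hlim).
  by rewrite hrho.
by case: (c); rewrite /= ?oner_neq0// gt_eqF.
Qed.

Lemma local_equilibrium a p t : 0 <= t -> f a p t = rho a t * normal_pdf (phi a t) s p.
Proof.
move=> t0; have df := regular_decaying [::] a rf t0.
have f0 q : 0 <= f a q t by exact: (limit_ge0 hsol rf rf1 hlim).
(* Where the mass is zero, the nonnegative continuous [f] vanishes, whatever the value of [phi]. *)
have [r0|rn0] := eqVneq (rho a t) 0.
  rewrite r0 mul0r; apply: (integral_eq0_decaying df f0).
  by rewrite hrho.
have r0 : 0 < rho a t by rewrite lt_neqAle eq_sym rn0 rho_ge0.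
have rI : 0 < \int[mu]_q f a q t by rewrite hrho.
have Q0 q : Q c gamma kappa zeta (fun q => f a q t) q = 0.
  have Bn0 := limit_convolution_neq0 q t0 r0.
  by have [] := limit_equation zeta0 hsol rf rf1 hlim t0 Bn0.
have eqf := @equilibrium_normalize R gamma kappa zeta c zeta0 (fun q => f a q t) _ _
  df f0 (is_derive_opinion a rf t0 [::]) (is_derive_opinion a rf t0 [:: Opinion]) rI Q0.
have [m mE] := heq eqf.
have fE q : f a q t = rho a t * normal_pdf m s q.
  by rewrite -mE hrho// mulVKf.
have := hphi a t0.
have -> : (fun q => f a q t * q) = (fun q => rho a t * (normal_pdf m s q * q)).
  by apply/funext => q; rewrite fE mulrA.
rewrite RintegralZ_decaying; last first.
  have := decaying_mulX 0 (decaying_normal_pdf s0 m); congr decaying.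
  by apply/funext => q; rewrite subr0 mulrC.
by rewrite (Rintegral_normal_pdf_id s0) => /(mulfI rn0) <-.
Qed.

Lemma limit_bigO :
  bigO_eps2 (fun e a p t => feps e a p t - rho a t * normal_pdf (phi a t) s p).
Proof.
(* [C0] bounds the seminorm of [f1]; the 1 is the tolerance chosen for the remainder. *)
move=> r k m; have [C0 f1C] := rf1.2 r k m; exists (1 + C0).
have [sf _] := rf; have [sf1 _] := rf1.
apply: filterS2 (near_regular hsol) (hlim r k m (@ltr01 R)) => e re he a p t ar tr.
have /andP[t0 _] := tr; have := he a p t ar tr.
rewrite (pderives_remainder rf rf1 k a p re t0) => h1; have h2 := f1C a p t ar tr.
rewrite (@pderives_ext _ _ _ _ (fun a p t => feps e a p t + - 1 * f a p t))//; last first.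
  by move=> b q u u0; rewrite (local_equilibrium b q u0) mulN1r.
rewrite pderives_lin//; [|exact: (smooth_all_pderivable re.1)|exact: smooth_all_pderivable].
have e20 : 0 <= e ^+ 2 by exact: sqr_ge0.
set x := pderives k (feps e) a p t in h1 *; set y := pderives k f a p t in h1 *.
set z := pderives k f1 a p t in h1 h2.
have -> : x + -1 * y = (x - y - e ^+ 2 * z) + e ^+ 2 * z by ring.
rewrite mulrDl [C0 * _]mulrC.
apply: le_trans (lerD h1 (ler_wpM2l e20 h2)).
have -> : e ^+ 2 * (`|p| ^+ m * `|z|) = `|p| ^+ m * `|e ^+ 2 * z|.
  by rewrite [in RHS]normrM (ger0_norm e20) mulrCA.
rewrite -mulrDr; apply: ler_wpM2l; first by rewrite exprn_ge0.
exact: ler_normD.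
Qed.

Lemma diffusion a t : 0 <= t -> 0 < rho a t ->
  is_time_derive (rho a) t 0 /\
  [/\ forall i, \forall b \near a, derivable (phi ^~ t) b (delta_mx 0 i),
      forall i, derivable (fun b => (rho b t ^+ 2 *: grad (phi ^~ t) b) 0 i)
        a (delta_mx 0 i) &
      is_time_derive (fun s => rho a s * phi a s) t
        (let J := divergence (fun b => rho b t ^+ 2 *: grad (phi ^~ t) b) a in
         match c with
         | Symmetric => C_s gamma kappa zeta D * J
         | NonSymmetric => C_a gamma kappa zeta D / rho a t * J
         end)].
Proof.
move=> t0 r0; have [sf _] := rf; have leE := local_equilibrium.
have [dr [dp [Dr Dp Drp ftE]]] := time_derivatives s0 sf leE t0 r0.
pose ri i := rho_i s f rho phi t i a; pose pi_ i := phi_i s f t i a.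
have /choice[q qE] i : exists q : R * R,
    is_derive a (delta_mx 0 i) (rho_i s f rho phi t i) q.1 /\
    is_derive a (delta_mx 0 i) (phi_i s f t i) q.2.
  have [rii [pii [d1 d2]]] := second_derivatives s0 sf leE i t0 r0.
  by exists (rii, pii).
have dJ i := is_derive_momentum_flux s0 sf leE t0 r0 (qE i).2.
pose v := s ^+ 2.
pose P0 := \sum_i ((q i).1 - rho a t * pi_ i ^+ 2 / v).
pose P1 := \sum_i ((2 * ri i * pi_ i + rho a t * (q i).2) / v).
pose P2 := \sum_i (rho a t * pi_ i ^+ 2 / v ^+ 2).
have v0 : 0 < v by exact: exprn_gt0.
have JE : divergence (fun b => rho b t ^+ 2 *: grad (phi ^~ t) b) a = rho a t * v * P1.
  rewrite /divergence /P1 mulr_sumr; apply: eq_bigr => i _.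
  rewrite /partial; have [_ ->] := dJ i; rewrite -/(ri i) -/(pi_ i).
  by field; rewrite gt_eqF.
have hE x : lap f a t x = (P0 + P1 * (x - phi a t) + P2 * (x - phi a t) ^+ 2)
    * normal_pdf (phi a t) s x.
  rewrite /lap (eq_bigr _ (fun i _ => second_derivative_f s0 sf leE t0 x r0
    (qE i).1 (qE i).2)) -mulr_suml.
  congr (_ * _); rewrite /P0 /P1 /P2 !mulr_suml -!big_split; apply: eq_bigr => i _.
  reflexivity.
have dg k := regular_decaying k a rf t0; have dw k := regular_decaying k a rf1 t0.
have gd k := is_derive_opinion a rf t0 k; have wd k := is_derive_opinion a rf1 t0 k.
have dh := decaying_lap a rf t0.
have leE' x := leE a x t t0.
have limE x := (limit_equation zeta0 hsol rf rf1 hlim t0 (limit_convolution_neq0 x t0 r0)).2.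
have [dr0 W] := @flux_balance R gamma kappa zeta D s (rho a t) (phi a t) dr dp
  zeta0 s0 r0 _ _ _ _ _ _ _
  (dg [::]) (dg [:: Opinion]) (dw [::]) (dw [:: Opinion]) dh
  (gd [::]) (gd [:: Opinion]) (wd [::]) (wd [:: Opinion]) leE' c
  (fun x => etrans (congr1 (fun y => y + _) (esym (ftE x))) (limE x)).
split; first by rewrite -dr0.
split.
- move=> i; apply: filterS (near_density_gt0 s0 sf leE t0 r0) => b rb.
  by have [] := is_derive_phi s0 sf leE i t0 rb.
- by move=> i; have [] := dJ i.
(* With [dr = 0] the derivative of [rho * phi] is [rho * dp], the quantity computed by the flux
   balance. *)
rewrite /= JE; move: Drp; rewrite dr0 mulr0 addr0; congr is_time_derive.
have int := @integral_drift_lap R zeta s (rho a t) (phi a t) P0 P1 P2 zeta0 s0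
  _ _ (dg [::]) leE' hE.
apply: (transport_coefficient kappa0 zeta0 hc erefl r0).
rewrite -int.
apply: (momentum_balance zeta0 s0 r0 (dg [::]) (dg [:: Opinion]) (dw [::])
    (dw [:: Opinion]) dh (gd [::]) (wd [::]) leE' _ W).
by move=> cN; move: hc; rewrite cN; exact: nonsymmetric_drift.
Qed.

End hydrodynamic_limit.

Theorem theorem4p4 (R : realType) (n : nat) (hn : (1 <= n <= 3)%N)
  (F : R -> R) (hF : interaction_kernel n F)
  (gamma kappa zeta : R)
  (hgamma : 0 < gamma) (hkappa : 0 < kappa) (hzeta : 0 < zeta)
  (c : model_case) (hc : kappa_condition c kappa zeta)
  (heq : forall g : R -> R, equilibrium c gamma kappa zeta g <->
           exists phi : R, g = normal_pdf phi (sigma c kappa zeta))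
  (feps : R -> phase_fun R n) (f : phase_fun R n)
  (hsol : \forall e \near 0^'+,
     solution c gamma kappa zeta (diffusion_constant n F) e (feps e))
  (hlim : converges_nicely feps f)
  (rho phi : 'rV[R]_n -> R -> R)
  (hrho : forall a t, 0 <= t ->
     \int[lebesgue_measure]_p f a p t = rho a t)
  (hphi : forall a t, 0 <= t ->
     \int[lebesgue_measure]_p (f a p t * p) = rho a t * phi a t) :
  [/\ (* local equilibrium *)
      forall a p t, 0 <= t ->
        f a p t = rho a t * normal_pdf (phi a t) (sigma c kappa zeta) p,
      bigO_eps2 (fun e a p t => feps e a p t -
        rho a t * normal_pdf (phi a t) (sigma c kappa zeta) p),
      forall a t, 0 <= t -> is_time_derive (rho a) t 0 &
      (* diffusion equation where rho > 0; the spatial derivatives exist *)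
      forall a t, 0 <= t -> 0 < rho a t ->
        [/\ forall i, \forall b \near a,
              derivable (phi ^~ t) b (delta_mx 0 i),
            forall i, derivable
              (fun b => (rho b t ^+ 2 *: grad (phi ^~ t) b) 0 i)
              a (delta_mx 0 i) &
            is_time_derive (fun s => rho a s * phi a s) t
              (let J := divergence
                 (fun b => rho b t ^+ 2 *: grad (phi ^~ t) b) a in
               match c with
               | Symmetric =>
                   C_s gamma kappa zeta (diffusion_constant n F) * J
               | NonSymmetric =>
                   C_a gamma kappa zeta (diffusion_constant n F) / rho a t * J
               end)]].
Proof.
have [rf [f1 rf1 hl]] := hlim.
have heq' g : equilibrium c gamma kappa zeta g ->
  exists m : R, g = normal_pdf m (sigma c kappa zeta) by move/heq.
have [s0 _] := sigma_sqr hkappa hzeta hc.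
have leE := local_equilibrium hkappa hzeta hc heq' hsol rf rf1 hl hrho hphi.
have diff := diffusion hkappa hzeta hc heq' hsol rf rf1 hl hrho hphi.
split=> //.
- exact: (limit_bigO hkappa hzeta hc heq' hsol rf rf1 hl hrho hphi).
(* [diff] gives the zero derivative where the mass is positive; smallness of the mass near its zeros
   supplies the other times. *)
- move=> a; apply: constant_of_time_derive0_pos.
  + by move=> t t0; exact: (rho_ge0 hsol rf rf1 hl hrho).
  + by move=> t t0 r0; have [] := diff a t t0 r0.
  + move=> t t0 r0 e e0; apply: (density_small_near s0 rf leE) => //.
    by move=> b u u0; exact: (rho_ge0 hsol rf rf1 hl hrho).
- by move=> a t t0 r0; have [_] := diff a t t0 r0.
Qed.
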